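(* Let $T$ be a linear involution on the alphabet $A$ without connection and let $S=\mathcal{L}(T)$. For any subgroup $G$ of finite index of the free group $F_A$, the set of prime words in $S$ with respect to $G$ is a symmetric basis of $G$.
   Context: Let $A$ be a finite alphabet with $k$ letters, $A^{-1}$ a disjoint copy with $(a^{-1})^{-1}=a$; $F_A$ is the free group on $A$. Let $I\subset\mathbb{R}$ be an open interval, $\hat I=I\times\{0,1\}$. Given a bijection $\pi:\{1,\dots,2k\}\to A\cup A^{-1}$, integers $\ell+m=2k$ and lengths $\lambda_a=\lambda_{a^{-1}}\ge0$ with $\sum_{i\le\ell}\lambda_{\pi(i)}=\sum_{i>\ell}\lambda_{\pi(i)}$, partition $I\times\{0\}$ minus $\ell-1$ points into consecutive open intervals $I_{\pi(1)},\dots,I_{\pi(\ell)}$ and $I\times\{1\}$ minus $m-1$ points into $I_{\pi(\ell+1)},\dots,I_{\pi(2k)}$ of these lengths; $\Sigma$ is the set of division points. The linear involution is $T=\sigma_2\circ\sigma_1$ on $\hat I\setminus\Sigma$, where $\sigma_1$ maps each $I_a$ onto $I_{a^{-1}}$ by a translation or a symmetry, and $\sigma_2(x,\delta)=(x,1-\delta)$. A connection is a triple $(x,y,n)$ with $x\in\sigma_2(\Sigma)$, $y\in\Sigma$, $n\ge0$, $T^n(x)=y$. Let $O=\bigcup_{n\ge0}T^{-n}(\Sigma)$, $\hat O=O\cup\sigma_2(O)$; for $z\in\hat I\setminus\hat O$, $\Sigma_T(z)=a_0a_1\cdots$ with $T^n(z)\in I_{a_n}$; the natural coding $\mathcal{L}(T)$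 is the set of finite factors of all $\Sigma_T(z)$, a set of reduced words viewed as a subset of $F_A$. The prime words in $S$ with respect to $G$ are the nonempty words of $G\cap S$ having no proper nonempty prefix in $G\cap S$. A symmetric basis of $G$ is a set $Y\cup Y^{-1}$ where $Y$ is a basis of $G$. *)

(* Defs.v *)
From HB Require Import structures.
From mathcomp Require Import all_boot all_order all_algebra.
From mathcomp Require Import all_classical reals.

Set Implicit Arguments.
Unset Strict Implicit.
Unset Printing Implicit Defensive.

Import Order.TTheory GRing.Theory Num.Theory.
Local Open Scope classical_set_scope.
Local Open Scope ring_scope.

(* The letter (a, false) stands for a and (a, true) for its formal inverse. *)
Definition letter (A : Type) : Type := (A * bool)%type.
Definition letter_inv (A : Type) (x : letter A) : letter A := (x.1, ~~ x.2).

Definition reduced (A : eqType) (w : seq (letter A)) : bool :=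
  sorted (fun x y : letter A => y != letter_inv x) w.

Record freegroup (A : choiceType) := FreeGroup {
  fg_word :> seq (letter A);
  fg_reduced : reduced fg_word }.

Section FreeGroup.
Context {A : choiceType}.
Implicit Types (x y : letter A) (u v w : seq (letter A)) (g h : freegroup A).

HB.instance Definition _ := [isSub for @fg_word A].
HB.instance Definition _ := [Choice of freegroup A by <:].

Definition fg_push x w :=
  if w is y :: w' then if y == letter_inv x then w' else x :: w else [:: x].

Definition word_mul u v := foldr fg_push v u.
Definition word_inv u := rev (map (@letter_inv A) u).

Lemma letter_invK : involutive (@letter_inv A).
Proof. by case=> a b; rewrite /letter_inv /= negbK. Qed.

Lemma reduced_behead x w : reduced (x :: w) -> reduced w.
Proof. exact: path_sorted. Qed.

Lemma reduced_push x w : reduced w -> reduced (fg_push x w).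
Proof.
case: w => [//|y w] yw /=; case: ifPn => [_|nyx]; first exact: reduced_behead yw.
by apply/andP.
Qed.

Lemma reduced_mul u v : reduced v -> reduced (word_mul u v).
Proof. by move=> rv; elim: u => [//|x u IH]; exact: reduced_push. Qed.

Lemma push_invK x w : reduced w -> fg_push x (fg_push (letter_inv x) w) = w.
Proof.
case: w => [|y w] yw /=; first by rewrite eqxx.
rewrite letter_invK; case: eqVneq => [yx|yx] /=; last by rewrite eqxx.
by case: w yw => [|z w]; rewrite yx //= => /andP[/negbTE->].
Qed.

Lemma word_mul1 u : reduced u -> word_mul u [::] = u.
Proof.
elim: u => [//|x u IH] ru /=; rewrite IH; last exact: reduced_behead ru.
by case: u ru {IH} => [//|y u] /= /andP[/negbTE->].
Qed.

Lemma word_mul_push x u v : reduced v ->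
  word_mul (fg_push x u) v = fg_push x (word_mul u v).
Proof.
case: u => [//|y u] rv /=; case: eqP => [->|//].
by rewrite push_invK // reduced_mul.
Qed.

Lemma word_mulA u v w : reduced w ->
  word_mul u (word_mul v w) = word_mul (word_mul u v) w.
Proof.
by move=> rw; elim: u => [//|x u IH] /=; rewrite IH word_mul_push.
Qed.

Lemma reduced_inv u : reduced u -> reduced (word_inv u).
Proof.
rewrite /reduced /word_inv rev_sorted sorted_map; apply: sub_sorted => x y /= yx.
by rewrite letter_invK; apply: contraNneq yx => ->; rewrite ?letter_invK.
Qed.

Lemma word_mulV u : word_mul (word_inv u) u = [::].
Proof.
elim: u => [//|x u IH]; rewrite /word_inv map_cons rev_cons /word_mul.
by rewrite foldr_rcons /= letter_invK eqxx; exact: IH.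
Qed.

Definition fg_one : freegroup A := @FreeGroup A [::] isT.
Definition fg_mul g h : freegroup A :=
  FreeGroup (reduced_mul g (fg_reduced h)).
Definition fg_inv g : freegroup A := FreeGroup (reduced_inv (fg_reduced g)).

Lemma fg_mulA : associative fg_mul.
Proof. by move=> g h k; apply/val_inj/word_mulA/fg_reduced. Qed.

Lemma fg_mul1g : left_id fg_one fg_mul.
Proof. by move=> g; apply/val_inj. Qed.

Lemma fg_mulg1 : right_id fg_one fg_mul.
Proof. by move=> g; apply/val_inj/word_mul1/fg_reduced. Qed.

Lemma fg_mulVg : left_inverse fg_one fg_inv fg_mul.
Proof. by move=> g; apply/val_inj/word_mulV. Qed.

Lemma fg_mulgV : right_inverse fg_one fg_inv fg_mul.
Proof.
move=> g; have gK : fg_inv (fg_inv g) = g.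
  apply/val_inj; rewrite /= /word_inv map_rev revK mapK //; exact: letter_invK.
by rewrite -{1}gK fg_mulVg.
Qed.

End FreeGroup.

HB.instance Definition _ (A : choiceType) :=
  isGroup.Build (freegroup A) (@fg_mulA A) (@fg_mul1g A) (@fg_mulg1 A)
    (@fg_mulVg A) (@fg_mulgV A).

Section Subgroups.
Context {F : groupType}.
Implicit Types (G X Y : set F).

Definition is_subgroup G : Prop := group_closed (mem G).

Definition finite_index G : Prop :=
  finite_set [set C : set F | exists g : F, C = [set (g * h)%g | h in G]].

(* The morphism from the free group on T to F that extends f. *)
Definition freegroup_lift (T : choiceType) (f : T -> F) (w : freegroup T) : F :=
  (\prod_(x <- fg_word w) (if x.2 then (f x.1)^-1 else f x.1))%g.

(* The morphism from the free group on Y induced by the inclusion is an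
   isomorphism onto G. *)
Definition is_basis G Y : Prop :=
  set_bij setT G (freegroup_lift (fun y : Y => val y)).

Definition symmetric_basis G X : Prop :=
  exists2 Y : set F, is_basis G Y & X = Y `|` [set (y^-1)%g | y in Y].

End Subgroups.

Definition prime_words (A : choiceType) (S G : set (freegroup A)) :
    set (freegroup A) :=
  [set g | [/\ (G `&` S) g, fg_word g <> [::] &
    forall h : freegroup A, (G `&` S) h -> fg_word h <> [::] ->
      prefix (fg_word h) (fg_word g) -> h = g]].

(* Points of I x {0, 1}, the boolean false standing for 0. *)
Definition point (R : Type) : Type := (R * bool)%type.

(* Positions are numbered from 0, so that the positions i < l are those of
   the component I x {0}. *)
Record li_data (R : realType) (A : finType) := LiData {
  li_left : R;
  li_right : R;
  li_l : nat;
  li_m : nat;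
  li_perm : 'I_(#|A|.*2) -> letter A;
  li_len : letter A -> R;
  (* li_flip a: sigma_1 is a symmetry (rather than a translation) on I_a *)
  li_flip : letter A -> bool;
  li_left_right : li_left < li_right;
  li_lm : (li_l + li_m)%N = #|A|.*2;
  li_perm_bij : bijective li_perm;
  li_len_ge0 : forall a, 0 <= li_len a;
  li_len_inv : forall a, li_len (letter_inv a) = li_len a;
  li_len_top : \sum_(i < #|A|.*2 | (i < li_l)%N) li_len (li_perm i)
               = li_right - li_left;
  li_len_bot : \sum_(i < #|A|.*2 | (li_l <= i)%N) li_len (li_perm i)
               = li_right - li_left;
  (* sigma_1 is an involution *)
  li_flip_inv : forall a, li_flip (letter_inv a) = li_flip a }.

Section LinearInvolution.
Context {R : realType} {A : finType}.
Implicit Types (D : li_data R A) (a b : letter A) (z : point R).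

Definition li_position D a : nat := index a (codom (li_perm D)).

Definition li_row D (i : nat) : bool := (li_l D <= i)%N.

Definition li_level D a : bool := li_row D (li_position D a).

Definition li_start D a : R :=
  li_left D + \sum_(j < #|A|.*2 | (li_row D j == li_level D a)
                                  && (j < li_position D a)%N)
                li_len D (li_perm D j).

Definition li_interval D a z : bool :=
  (li_start D a < z.1 < li_start D a + li_len D a) && (z.2 == li_level D a).

Definition li_Ihat D : set (point R) :=
  [set z | li_left D < z.1 < li_right D].

Definition li_Sigma D : set (point R) :=
  [set z | exists i j : 'I_(#|A|.*2),
     [/\ j = i.+1 :> nat, li_row D i = li_row D j &
         z = (li_start D (li_perm D j), li_row D j)]].

(* The translation or the symmetry that maps I_a onto I_(a^-1). *)
Definition li_move D a z : point R :=
  let b := letter_inv a in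
  (if li_flip D a then li_start D b + (li_start D a + li_len D a - z.1)
   else li_start D b + (z.1 - li_start D a), li_level D b).

Definition li_sigma1 D z : option (point R) :=
  omap (fun a => li_move D a z) [pick a | li_interval D a z].

Definition li_sigma2 z : point R := (z.1, ~~ z.2).

(* None outside the union of the intervals I_a. *)
Definition li_map D z : option (point R) := omap li_sigma2 (li_sigma1 D z).

Definition li_iter D (n : nat) z : option (point R) :=
  iter n (obind (li_map D)) (Some z).

Definition li_connection D (x y : point R) (n : nat) : Prop :=
  [/\ [set li_sigma2 s | s in li_Sigma D] x, li_Sigma D y &
      li_iter D n x = Some y].

Definition without_connection D : Prop :=
  ~ exists x y n, li_connection D x y n.

Definition li_O D : set (point R) :=
  [set z | exists n, exists2 y, li_Sigma D y & li_iter D n z = Some y].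

Definition li_Ohat D : set (point R) :=
  li_O D `|` [set li_sigma2 z | z in li_O D].

(* u is the infinite word Sigma_T(z). *)
Definition li_codes D z (u : nat -> letter A) : Prop :=
  forall n, exists2 z', li_iter D n z = Some z' & li_interval D (u n) z'.

Definition natural_coding D : set (seq (letter A)) :=
  [set w | exists z u p n,
     [/\ (li_Ihat D `\` li_Ohat D) z, li_codes D z u &
         w = mkseq (fun i => u (p + i)%N) n]].

Lemma li_interval_inj D a b z :
  li_interval D a z -> li_interval D b z -> a = b.
Proof.
have surj c : c \in codom (li_perm D).
  by have [g _ gK] := li_perm_bij D; rewrite -(gK c) codom_f.
wlog lt_ab : a b / (li_position D a < li_position D b)%N.
  move=> wl Ia Ib; case: (ltngtP (li_position D a) (li_position D b)) => ab.
  - exact: wl.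
  - exact/esym/wl.
  - by rewrite -(nth_index a (surj a)) -(nth_index a (surj b)); congr nth.
move=> /andP[/andP[_ lt_za] /eqP lev_a] /andP[/andP[lt_bz _] /eqP lev_b].
have lev : li_level D a = li_level D b by rewrite -lev_a.
have lt_a : (li_position D a < #|A|.*2)%N.
  by rewrite -[X in (_ < X)%N](card_ord (#|A|.*2)) -(size_codom (li_perm D))
             index_mem.
pose ia := Ordinal lt_a.
have perm_ia : li_perm D ia = a.
  rewrite -[RHS](nth_index a (surj a)) -/(li_position D a) codomE.
  by rewrite (nth_map ia) ?size_enum_ord // (nth_ord_enum ia ia).
have : li_start D a + li_len D a <= li_start D b.
  rewrite /li_start -addrA lerD2l lev.
  rewrite [leRHS](bigID (fun j : 'I_ _ => (j < li_position D a)%N)) /= lerD //.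
    rewrite le_eqVlt; apply/orP; left; apply/eqP/eq_bigl => j; rewrite -andbA.
    by congr (_ && _); case: ltnP => [/ltn_trans->|]; rewrite ?andbF.
  rewrite (bigD1 ia) /=; last by rewrite lt_ab ltnn -lev eqxx.
  by rewrite perm_ia lerDl sumr_ge0 // => j _; exact: li_len_ge0.
by rewrite leNgt (lt_trans lt_bz lt_za).
Qed.

Lemma natural_coding_reduced D w : natural_coding D w -> reduced w.
Proof.
move=> [z [u [p [n [_ codes ->]]]]]; apply/(sortedP (u 0)) => i.
rewrite size_mkseq => lt_in; rewrite !nth_mkseq //; last exact: ltnW.
rewrite addnS; set q := (p + i)%N.
have [z1 z1E I1] := codes q; have [z2 + I2] := codes q.+1.
rewrite /li_iter iterS -/(li_iter D q z) z1E /= /li_map /li_sigma1.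
case: pickP => [a Ia|//] [z2E]; rewrite (li_interval_inj I1 Ia).
apply/eqP => uE; move: I2 => /andP[_]; rewrite -z2E uE /=.
by case: (li_level _ _).
Qed.

(* This loses no word, by natural_coding_reduced. *)
Definition natural_coding_fg D : set (freegroup A) :=
  [set g | natural_coding D (fg_word g)].

End LinearInvolution.

(* A length datum may vanish, but removing l - 1 (resp. m - 1) points from an
   open interval leaves l (resp. m) nonempty intervals. *)
Record linear_involution (R : realType) (A : finType) := LinearInvolution {
  li_of :> li_data R A;
  li_nonempty : forall a, exists z, li_interval li_of a z }.

(* Main.v *)
Require Import Defs.
From mathcomp Require Import all_boot all_order all_algebra.
From mathcomp Require Import all_classical reals.
From mathcomp Require Import ereal lebesgue_measure ring lra.

(** Give every point of the strip I two one-sided germs. On germs T is a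
bijection that is defined everywhere, and sigma_2 reverses time, so the coding
is the set of finite words read along orbits of germs, and the prime words are
the words of the first returns to G in the skew product of T with the coset
action of F_A. The orbit of a germ is followed by a whole one-sided interval,
and since its letters change only at division points, a pigeonhole argument
shows that each germ of G returns to G, with a bounded return time.

Fix h outside G. From a germ of the strip of h the orbits in both time
directions reach G and form together a prime word. At an interior point b the
left and right germs may part in one time direction; if they did so in both,
the orbit of b would be a connection. So two neighbouring prime words that
cross the strip share either their future or their past.

Generation: let H be a subgroup that contains the prime words. The two ends of
a prime word that crosses the strip of h are in the same coset of H, so by
sharing futures or pasts all germs of the strip reach G inside H, or none
does. Moving from h to its neighbours shows that they all do; for h in G this
says that h is in H.

Freeness: given eta with eta(x^-1) = eta(x)^-1, spread eta over the strips by
splitting eta(x) as a past value times a future value, in such a way that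
neighbours that share their future (or past) have the same future (or past)
value. The label of a step, i.e. the quotient of the future values before and
after the step, then depends only on the letter and the coset. The holonomy of
these labels is multiplicative on G and extends the restriction of eta to the
prime words. With eta valued in the abstract free group this inverts the
canonical morphism. *)

Set Implicit Arguments.
Unset Strict Implicit.
Unset Printing Implicit Defensive.

Import Order.TTheory GRing.Theory Num.Theory.
Local Open Scope classical_set_scope.
Local Open Scope ring_scope.

(* (z, false) stands for the points just to the right of z, (z, true) for those
   just to its left. *)
Definition germ (R : Type) : Type := (Defs.point R * bool)%type.

Lemma li_sigma2K (R : realType) : involutive (@li_sigma2 R).
Proof. by case=> t s; rewrite /li_sigma2 /= negbK. Qed.

(** * One-sided germs *)

Section Germs.
Context {R : realType} {A : finType} (T : linear_involution R A).
Implicit Types (a b : letter A) (z : Defs.point R) (g : germ R) (d t : R).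

Lemma li_len_gt0 a : 0 < li_len T a.
Proof.
by have [z /andP[/andP[l1 l2] _]] := li_nonempty T a; have := lt_trans l1 l2;
  rewrite ltrDl.
Qed.

(** The index runs over the positions of both levels, those of the other level not moving the cut,
    so that the ends of all intervals of a level are values of one monotone function. *)
Definition li_cut (s : bool) (i : nat) : R :=
  li_left T + \sum_(j < #|A|.*2 | (li_row T j == s) && (j < i)%N)
                 li_len T (li_perm T j).

Lemma li_startE a : li_start T a = li_cut (li_level T a) (li_position T a).
Proof. by []. Qed.

Lemma li_cut0 s : li_cut s 0 = li_left T.
Proof.
by rewrite /li_cut big_pred0 ?addr0 // => j; rewrite ltn0 andbF.
Qed.

Lemma li_cut_end s : li_cut s #|A|.*2 = li_right T.
Proof.
rewrite /li_cut (eq_bigl (fun j : 'I_ _ => li_row T j == s)); last first.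
  by move=> j; rewrite ltn_ord andbT.
case: s.
  rewrite (eq_bigl (fun j : 'I_(#|A|.*2) => (li_l T <= j)%N)).
    by rewrite li_len_bot addrC subrK.
  by move=> j; rewrite eqb_id.
rewrite (eq_bigl (fun j : 'I_(#|A|.*2) => (j < li_l T)%N)).
  by rewrite li_len_top addrC subrK.
by move=> j; rewrite eqbF_neg -ltnNge.
Qed.

Lemma li_cutS s (i : 'I_(#|A|.*2)) :
  li_cut s i.+1 = li_cut s i + (if li_row T i == s then li_len T (li_perm T i) else 0).
Proof.
rewrite /li_cut -addrA; congr (_ + _); case: ifP => rs.
  rewrite (bigD1 i) /=; last by rewrite rs ltnSn.
  rewrite addrC; congr (_ + _); apply: eq_bigl => j.
  by rewrite -[LHS]andbA; case: (_ == s) => //=; rewrite ltnS ltn_neqAle andbC.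
rewrite addr0; apply: eq_bigl => j /=; rewrite ltnS leq_eqVlt andb_orr.
by case: (eqVneq (j : nat) i) => [/val_inj ->|]; rewrite ?rs ?andbF.
Qed.

Lemma li_cut_le s i j : (i <= j)%N -> li_cut s i <= li_cut s j.
Proof.
move=> ij; rewrite /li_cut lerD2l [leRHS](bigID (fun k : 'I_ _ => (k < i)%N)) /=.
rewrite [X in X <= _](_ : _ =
  \sum_(k < #|A|.*2 | (li_row T k == s) && (k < j)%N && (k < i)%N) li_len T (li_perm
    T k)).
  by rewrite lerDl sumr_ge0 // => k _; exact: li_len_ge0.
apply: eq_bigl => k; rewrite -andbA; congr (_ && _).
by case: (ltnP k i) => [/leq_trans->|]; rewrite ?andbF.
Qed.

Lemma li_permP a : exists2 i : 'I_(#|A|.*2), li_perm T i = a & li_position T a =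
  i :> nat.
Proof.
have surj : a \in codom (li_perm T).
  by have [g _ gK] := li_perm_bij T; rewrite -(gK a) codom_f.
have lt_a : (li_position T a < #|A|.*2)%N.
  by rewrite -[X in (_ < X)%N](card_ord (#|A|.*2)) -(size_codom (li_perm T)) index_mem.
exists (Ordinal lt_a) => //.
rewrite -[RHS](nth_index a surj) -/(li_position T a) codomE.
by rewrite (nth_map (Ordinal lt_a)) ?size_enum_ord // (nth_ord_enum (Ordinal lt_a)
  (Ordinal lt_a)).
Qed.

Lemma li_position_perm (i : 'I_(#|A|.*2)) : li_position T (li_perm T i) = i.
Proof.
have [j ji ->] := li_permP (li_perm T i); congr nat_of_ord.
exact: bij_inj (li_perm_bij T) _ _ ji.
Qed.

Lemma li_position_inj a b : li_position T a = li_position T b -> a = b.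
Proof.
have [i <- ->] := li_permP a; have [j <- ->] := li_permP b.
by move=> /val_inj ->.
Qed.

Lemma li_endE a :
  li_start T a + li_len T a = li_cut (li_level T a) (li_position T a).+1.
Proof.
have [i pi posi] := li_permP a.
by rewrite li_startE posi li_cutS pi /li_level posi eqxx.
Qed.

(** A germ at an end of an interval belongs to the interval that it looks into, so the half-open
    intervals tile the germs of each level without exceptional points. *)
Definition germ_in a g : bool :=
  (g.1.2 == li_level T a) &&
  (if g.2 then li_start T a < g.1.1 <= li_start T a + li_len T a
   else li_start T a <= g.1.1 < li_start T a + li_len T a).

Definition germ_valid g : bool :=
  if g.2 then li_left T < g.1.1 <= li_right T
  else li_left T <= g.1.1 < li_right T.

Lemma li_start_ge a : li_left T <= li_start T a.
Proof. by rewrite li_startE -(li_cut0 (li_level T a)) li_cut_le. Qed.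

Lemma li_end_le a : li_start T a + li_len T a <= li_right T.
Proof.
have [i _ posi] := li_permP a.
by rewrite li_endE -(li_cut_end (li_level T a)) li_cut_le // posi.
Qed.

Lemma germ_in_valid a g : germ_in a g -> germ_valid g.
Proof.
have := li_start_ge a; have := li_end_le a; rewrite /germ_in /germ_valid.
by case: g => [[t s] []] /= ? ? /andP[_ /andP[? ?]]; apply/andP; split; lra.
Qed.

Lemma germ_in_uniq a b g : germ_in a g -> germ_in b g -> a = b.
Proof.
wlog ab : a b / (li_position T a < li_position T b)%N.
  move=> wl ia ib; case: (ltngtP (li_position T a) (li_position T b)) => [ab|ab|].
  - exact: wl.
  - exact/esym/wl.
  - exact: li_position_inj.
move=> /andP[/eqP la ia] /andP[/eqP lb ib].
have : li_start T a + li_len T a <= li_start T b.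
  by rewrite li_endE li_startE -la -lb li_cut_le.
by move: ia ib; case: ifP => _ /andP[? ?] /andP[? ?] ?; exfalso; lra.
Qed.

Lemma germ_in_ex g : germ_valid g -> exists a, germ_in a g.
Proof.
case: g => [[t s] e] gv.
pose P i := if e then t <= li_cut s i else t < li_cut s i.
have exP : exists i, P i.
  by exists #|A|.*2; rewrite /P li_cut_end; move: gv; rewrite /germ_valid /=;
    case: e {P} => /andP[].
(* Take the first cut past the germ. The position before it is on level [s], since otherwise the two
   cuts would coincide, against minimality. *)
case: (ex_minnP exP) => -[|i] Pi mini.
  by move: gv Pi; rewrite /germ_valid /P li_cut0 /=;
    case: e {P exP mini} => /andP[? ?] ?; exfalso; lra.
have ltiK : (i < #|A|.*2)%N.
  apply: mini; move: gv; rewrite /P li_cut_end /germ_valid /=.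
  by case: e {P exP Pi} => /andP[].
have nPi : ~~ P i by apply/negP => /mini; rewrite ltnn.
exists (li_perm T (Ordinal ltiK));
  rewrite /germ_in /li_level li_endE /li_level li_startE /li_level.
rewrite li_position_perm /=.
have rowi : li_row T i = s.
  case: (li_row T i =P s) => [//|/eqP/negbTE rs].
  have := li_cutS s (Ordinal ltiK); rewrite /= rs addr0 => E.
  by move: Pi nPi; rewrite /P E => ->.
rewrite rowi eqxx /=; move: Pi nPi; rewrite /P.
by case: e {P exP mini gv} => [-> /negP|-> /negP]; rewrite andbT => /negP;
  rewrite -?ltNge -?leNgt.
Qed.

Context (a0 : letter A).

(** The default [a0] is reached only for germs that are not valid. *)
Definition germ_letter g : letter A := odflt a0 [pick a | germ_in a g].

Lemma germ_letterP g : germ_valid g -> germ_in (germ_letter g) g.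
Proof.
move=> /germ_in_ex[a ia]; rewrite /germ_letter; case: pickP => [//|/(_ a)].
by rewrite ia.
Qed.

Lemma germ_letterE a g : germ_in a g -> germ_letter g = a.
Proof.
by move=> ia; apply: (germ_in_uniq _ ia); apply: germ_letterP (germ_in_valid ia).
Qed.

Definition germ_rev g : germ R := (li_sigma2 g.1, g.2).
Definition germ_opp g : germ R := (g.1, ~~ g.2).
(* The germ at distance d from g on the side of g; it looks in the same
   direction as g iff e = false. *)
Definition germ_shift g d (e : bool) : germ R :=
  ((g.1.1 + (if g.2 then - d else d), g.1.2), g.2 (+) e).

Definition germ_step a g : germ R :=
  (li_sigma2 (li_move T a g.1), g.2 (+) li_flip T a).
Definition germ_map g : germ R := germ_step (germ_letter g) g.

(** Distance to the end of the interval in the direction of the germ; shifts by less keep the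
    letter. *)
Definition germ_room g : R :=
  let a := germ_letter g in
  if g.2 then g.1.1 - li_start T a else li_start T a + li_len T a - g.1.1.

Lemma germ_revK : involutive germ_rev.
Proof. by case=> [[t s] e]; rewrite /germ_rev /li_sigma2 /= negbK. Qed.

Lemma germ_valid_rev g : germ_valid (germ_rev g) = germ_valid g.
Proof. by []. Qed.

Lemma germ_rev_opp g : germ_rev (germ_opp g) = germ_opp (germ_rev g).
Proof. by []. Qed.

Lemma germ_step_in a g :
  germ_in a g -> germ_in (letter_inv a) (germ_rev (germ_step a g)).
Proof.
rewrite /germ_in /germ_rev /germ_step /li_move /li_sigma2.
case: g => [[t s] e] /= /andP[_].
rewrite negbK eqxx /= li_len_inv.
by case: (li_flip T a); case: e => /= /andP[? ?]; apply/andP; split; lra.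
Qed.

Lemma germ_step_rev a g : germ_in a g ->
  germ_step (letter_inv a) (germ_rev (germ_step a g)) = germ_rev g.
Proof.
rewrite /germ_in /germ_rev /germ_step /li_move /li_sigma2 li_flip_inv letter_invK.
case: g => [[t s] e] /= /andP[/eqP -> _]; rewrite li_len_inv.
by case: (li_flip T a); congr (_, _, _); rewrite ?addbT ?addbF ?negbK //=; ring.
Qed.

Lemma germ_room_gt0 g : germ_valid g -> 0 < germ_room g.
Proof.
move=> /germ_letterP; rewrite /germ_room /germ_in.
by case: g => [[t s] []] /= /andP[_ /andP[? ?]]; lra.
Qed.

(** The condition [e -> 0 < d] excludes the opposite germ at the same point, which may lie in
    another interval. *)
Lemma germ_shift_in a g d (e : bool) : germ_in a g -> 0 <= d -> (e -> 0 < d) ->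
  d < germ_room g -> germ_in a (germ_shift g d e).
Proof.
move=> ia; rewrite /germ_room (germ_letterE ia); move: ia; rewrite /germ_in /germ_shift.
case: g => [[t s] []] /= /andP[-> /andP[? ?]] ? ed ?.
all: by case: e ed => [/(_ isT) ?|_] /=; apply/andP; split; lra.
Qed.

Lemma germ_step_shift a g d (e : bool) :
  germ_step a (germ_shift g d e) = germ_shift (germ_step a g) d e.
Proof.
rewrite /germ_step /germ_shift /li_sigma2 /li_move /=; case: g => [[t s] u] /=.
by case: (li_flip T a); case: u; case: e; congr (_, _, _); rewrite //=; ring.
Qed.

Lemma germ_step_opp a g : germ_step a (germ_opp g) = germ_opp (germ_step a g).
Proof. by rewrite /germ_step /germ_opp /= addNb. Qed.

Lemma germ_map_valid g : germ_valid g -> germ_valid (germ_map g).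
Proof.
by move=> gv; rewrite -germ_valid_rev;
  apply: germ_in_valid (germ_step_in (germ_letterP gv)).
Qed.

Lemma germ_letter_rev g : germ_valid g ->
  germ_letter (germ_rev (germ_map g)) = letter_inv (germ_letter g).
Proof. by move=> /germ_letterP/germ_step_in/germ_letterE. Qed.

(** T followed by [sigma_2] is [sigma_1], an involution, so conjugation by [sigma_2] inverts T. *)
Lemma germ_map_rev g : germ_valid g ->
  germ_map (germ_rev (germ_map g)) = germ_rev g.
Proof.
move=> gv; rewrite {1}/germ_map germ_letter_rev //.
exact: germ_step_rev (germ_letterP gv).
Qed.

Definition germ_iter n g := iter n germ_map g.

Lemma germ_iterSr n g : germ_iter n.+1 g = germ_iter n (germ_map g).
Proof. exact: iterSr. Qed.

Lemma germ_iterD m n g : germ_iter (m + n) g = germ_iter m (germ_iter n g).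
Proof. exact: iterD. Qed.

Lemma germ_iter_valid n g : germ_valid g -> germ_valid (germ_iter n g).
Proof. by move=> gv; elim: n => [//|n IH]; exact: germ_map_valid. Qed.

Lemma germ_iter_rev n g : germ_valid g ->
  germ_iter n (germ_rev (germ_iter n g)) = germ_rev g.
Proof.
move=> gv; elim: n => [//|n IH].
by rewrite germ_iterSr /= germ_map_rev ?germ_iter_valid.
Qed.

Lemma germ_iter_inj n g h : germ_valid g -> germ_valid h ->
  germ_iter n g = germ_iter n h -> g = h.
Proof.
move=> gv hv E; apply: (can_inj germ_revK).
by rewrite -(germ_iter_rev n gv) E germ_iter_rev.
Qed.

Lemma germ_shift_map g d (e : bool) : germ_valid g -> 0 <= d -> (e -> 0 < d) ->
  d < germ_room g ->
  germ_letter (germ_shift g d e) = germ_letter g /\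
  germ_map (germ_shift g d e) = germ_shift (germ_map g) d e.
Proof.
move=> gv d0 ed dr; have E : germ_letter (germ_shift g d e) = germ_letter g.
  exact/germ_letterE/germ_shift_in/dr/ed/d0/germ_letterP.
by rewrite {1}/germ_map E germ_step_shift.
Qed.

Lemma germ_shift_iter g d (e : bool) n : germ_valid g -> 0 <= d -> (e -> 0 < d) ->
  (forall i, (i < n)%N -> d < germ_room (germ_iter i g)) ->
  (forall i, (i < n)%N ->
     germ_letter (germ_iter i (germ_shift g d e)) = germ_letter (germ_iter i g)) /\
  (forall i, (i <= n)%N ->
     germ_iter i (germ_shift g d e) = germ_shift (germ_iter i g) d e).
Proof.
move=> gv d0 ed dr.
have S i : (i <= n)%N -> germ_iter i (germ_shift g d e) =
  germ_shift (germ_iter i g) d e.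
  elim: i => [//|i IH] ltin; rewrite /= -/(germ_iter _ _) IH 1?ltnW //.
  by have [] := germ_shift_map (germ_iter_valid i gv) d0 ed (dr i ltin).
split=> // i ltin; rewrite S 1?ltnW //.
by have [] := germ_shift_map (germ_iter_valid i gv) d0 ed (dr i ltin).
Qed.

Lemma germ_slide_iter g d n : germ_valid g -> 0 <= d ->
  (forall i, (i < n)%N -> d < germ_room (germ_iter i g)) ->
  (forall i, (i < n)%N ->
     germ_letter (germ_iter i (germ_shift g d false)) = germ_letter (germ_iter i g)) /\
  (forall i, (i <= n)%N ->
     germ_iter i (germ_shift g d false) = germ_shift (germ_iter i g) d false).
Proof. by move=> gv d0; exact: germ_shift_iter. Qed.

Lemma germ_room_iter_bound g n : germ_valid g ->
  exists2 eps, 0 < eps & forall i, (i < n)%N -> eps <= germ_room (germ_iter i g).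
Proof.
move=> gv; elim: n => [|n [eps e0 epsP]]; first by exists 1.
exists (Num.min eps (germ_room (germ_iter n g))).
  by rewrite lt_min e0 germ_room_gt0 ?germ_iter_valid.
move=> i; rewrite ltnS leq_eqVlt ge_min => /predU1P[->|/epsP ->//].
by rewrite lexx orbT.
Qed.

Lemma germ_shift_valid g d (e : bool) : germ_valid g -> 0 <= d -> (e -> 0 < d) ->
  d < germ_room g -> germ_valid (germ_shift g d e).
Proof.
by move=> gv d0 ed dr; exact/germ_in_valid/germ_shift_in/dr/ed/d0/germ_letterP.
Qed.

Definition germ_interior g : bool := li_left T < g.1.1 < li_right T.

Lemma germ_interior_valid g : germ_interior g -> germ_valid g.
Proof.
rewrite /germ_interior /germ_valid; case: g => [[t s] []] /= /andP[? ?].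
all: by apply/andP; split; lra.
Qed.

Lemma li_division z a b : li_Ihat T z ->
  germ_in a (z, true) -> germ_in b (z, false) -> a <> b -> li_Sigma T z.
Proof.
rewrite /li_Ihat /germ_in; case: z => [t s] /= /andP[lt tr].
move=> /andP[/eqP la /andP[sa ea]] /andP[/eqP lb /andP[sb eb]] ab.
have [i pa posa] := li_permP a; have [j pb posb] := li_permP b.
have ltij : (i < j)%N.
  rewrite ltnNge; apply/negP; rewrite leq_eqVlt => /predU1P[ji|ji].
    by apply: ab; apply: li_position_inj; rewrite posa posb ji.
  have : li_cut s j.+1 <= li_cut s i by exact: li_cut_le.
  have -> : li_cut s j.+1 = li_start T b + li_len T b by rewrite li_endE posb lb.
  have -> : li_cut s i = li_start T a by rewrite li_startE posa la.
  by move=> ?; lra.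
(* The position just before that of [b] is on the same level, because the levels are contiguous
   blocks of positions and [a] comes before [b]. *)
have K : (j.-1 < #|A|.*2)%N by exact: leq_ltn_trans (leq_pred _) (ltn_ord j).
have jS : j.-1.+1 = j by rewrite prednK // (leq_trans _ ltij).
have rj : li_row T j = s by rewrite lb /li_level posb.
have ri : li_row T i = s by rewrite la /li_level posa.
exists (Ordinal K), j; split=> //=.
  rewrite rj; case: s rj ri {la lb} => rj ri.
    by rewrite /li_row /= (leq_trans ri) // -ltnS jS.
  apply: contraFF rj; rewrite /li_row /= => /leq_trans; apply; exact: leq_pred.
congr (_, _) => //; apply/eqP; rewrite eq_le pb sb andbT.
by apply: le_trans ea _; rewrite li_endE li_startE -la -lb li_cut_le // posa posb.
Qed.

Lemma germ_opp_in g : germ_interior g -> ~ li_Sigma T g.1 ->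
  germ_letter (germ_opp g) = germ_letter g /\ li_interval T (germ_letter g) g.1.
Proof.
move=> gi nS.
have gv := germ_interior_valid gi;
  have ov : germ_valid (germ_opp g) by exact: germ_interior_valid.
have ig := germ_letterP gv; have io := germ_letterP ov.
have E : germ_letter (germ_opp g) = germ_letter g.
  apply: contrapT => ne; apply: nS; case: g gi gv ov ig io ne => z [] gi gv ov ig io ne.
    exact: (li_division gi ig io (nesym ne)).
  exact: (li_division gi io ig ne).
split=> //; rewrite E in io; move: ig io; rewrite /germ_in /li_interval.
case: (g) => [[t s] []] /= /andP[-> /andP[? ?]] /andP[_ /andP[? ?]].
all: by rewrite andbT; apply/andP; split; lra.
Qed.

Lemma li_interval_germ a z e : li_interval T a z -> germ_in a (z, e).
Proof.
rewrite /germ_in /li_interval; case: e => /= /andP[/andP[? ?] ->] /=.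
all: by apply/andP; split; lra.
Qed.

Lemma li_map_germ a z e : li_interval T a z ->
  li_map T z = Some (germ_map (z, e)).1.
Proof.
move=> ia; rewrite /li_map /li_sigma1 /germ_map (germ_letterE (li_interval_germ e ia)).
case: pickP => [b ib /=|/(_ a)]; last by rewrite ia.
by rewrite (li_interval_inj ib ia).
Qed.

Lemma li_interval_interior a g : li_interval T a g.1 -> germ_interior g.
Proof.
have := li_start_ge a; have := li_end_le a; rewrite /germ_interior /li_interval.
by move=> ? ? /andP[/andP[? ?] _]; apply/andP; split; lra.
Qed.

Lemma li_interval_move a z : li_interval T a z ->
  li_interval T (letter_inv a) (li_move T a z).
Proof.
rewrite /li_interval /li_move; case: z => [t s] /= /andP[/andP[? ?] _].
rewrite eqxx andbT li_len_inv.
by case: (li_flip T a) => /=; apply/andP; split; lra.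
Qed.

Lemma germ_map_interior a g : li_interval T a g.1 -> germ_interior (germ_map g).
Proof.
case: g => z e /= ia; rewrite /germ_map (germ_letterE (li_interval_germ e ia)).
exact: (@li_interval_interior (letter_inv a) (li_move T a z, e)) (li_interval_move ia).
Qed.

Lemma li_mapP z z' : li_map T z = Some z' -> exists a, li_interval T a z.
Proof. by rewrite /li_map /li_sigma1; case: pickP => [a ia _|//]; exists a. Qed.

Lemma li_map_rev z z' : li_map T z = Some z' ->
  li_map T (li_sigma2 z') = Some (li_sigma2 z).
Proof.
move=> zz'; have [a ia] := li_mapP zz'.
have E : z' = li_sigma2 (li_move T a z).
  by move: zz'; rewrite (li_map_germ false ia) => -[<-];
    rewrite /germ_map (germ_letterE (li_interval_germ _ ia)).
have gv := germ_in_valid (li_interval_germ false ia).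
have K : li_sigma2 z' = li_move T a z by rewrite E li_sigma2K.
rewrite K (li_map_germ (li_flip T a) (li_interval_move ia)); congr Some.
have := germ_map_rev gv;
  rewrite {2}/germ_map (germ_letterE (li_interval_germ false ia)).
rewrite {1}/germ_step {1}/germ_rev /= li_sigma2K => E2; exact: (congr1 fst E2).
Qed.

Lemma li_iterS n z : li_iter T n.+1 z = obind (li_map T) (li_iter T n z).
Proof. by []. Qed.

Lemma li_iterSr n z : li_iter T n.+1 z = obind (li_iter T n) (li_map T z).
Proof.
rewrite /li_iter iterSr /=; case: (li_map T z) => //=.
by elim: n => [//|n] /= ->.
Qed.

Lemma li_iterD m n z : li_iter T (m + n) z = obind (li_iter T m) (li_iter T n z).
Proof.
elim: n z => [|n IH] z; first by rewrite addn0.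
by rewrite addnS !li_iterSr; case: (li_map T z) => //= z'; rewrite IH.
Qed.

Lemma li_iter_rev n z z' : li_iter T n z = Some z' ->
  li_iter T n (li_sigma2 z') = Some (li_sigma2 z).
Proof.
elim: n z z' => [|n IH] z z'; first by case=> ->.
rewrite li_iterSr li_iterS; case E: (li_map T z) => [y|//] /= /IH -> /=.
exact: li_map_rev.
Qed.


Definition opp_agree n g : Prop := forall i, (i < n)%N ->
  germ_letter (germ_iter i (germ_opp g)) = germ_letter (germ_iter i g).

(** By [germ_opp_in], opposite germs have the same letter off the division points, so they travel
    together until the orbit of their point meets one. *)
Lemma germ_opp_iter g n : germ_interior g ->
  (opp_agree n g
   /\ (forall i, (i <= n)%N -> germ_iter i (germ_opp g) = germ_opp (germ_iter i g))
   /\ germ_interior (germ_iter n g) /\ li_iter T n g.1 = Some (germ_iter n g).1)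
  \/ exists i y, [/\ (i < n)%N, li_Sigma T y & li_iter T i g.1 = Some y].
Proof.
move=> gi; elim: n => [|n [[L [M [gin itn]]]|[i [y [ltin Sy iy]]]]]; first by left;
  split=> //; split=> [[]|] //.
  have [Sn|nSn] := pselect (li_Sigma T (germ_iter n g).1).
    by right; exists n, (germ_iter n g).1.
  have [E ia] := germ_opp_in gin nSn; left; split; [|split; [|split]].
  - by move=> i; rewrite ltnS leq_eqVlt => /predU1P[->|/L//]; rewrite M.
  - move=> i; rewrite leq_eqVlt => /predU1P[->|/M//].
    by rewrite /= -/(germ_iter _ _) M // {1}/germ_map E germ_step_opp.
  - exact: germ_map_interior ia.
  - rewrite li_iterS itn /= (li_map_germ (germ_iter n g).2 ia).
    by rewrite -surjective_pairing.
by right; exists i, y; split=> //; exact: ltnW.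
Qed.

(** Otherwise the orbits of the point in both time directions would meet division points; running
    the second backwards and then the first gives a connection. *)
Lemma germ_cross g n m : without_connection T -> germ_interior g ->
  opp_agree n g \/ opp_agree m (germ_rev g).
Proof.
move=> nc gi; have gri : germ_interior (germ_rev g) by [].
have [[L _]|[i [y [_ Sy iy]]]] := germ_opp_iter n gi; first by left.
have [[L _]|[j [x [_ Sx jx]]]] := germ_opp_iter m gri; first by right.
case: nc; exists (li_sigma2 x), y, (i + j)%N; split=> //; first by exists x.
rewrite li_iterD (li_iter_rev jx) /=.
by rewrite /germ_rev li_sigma2K.
Qed.

End Germs.

(** A nonempty open interval has positive Lebesgue measure, whereas countable sets are null. *)
Lemma countable_avoid (R : realType) (C : set R) (eps : R) :
  countable C -> 0 < eps -> exists2 d, 0 < d < eps & ~ C d.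
Proof.
move=> Cc e0; apply: contrapT => H.
have sub : `]0, eps[%classic `<=` C.
  move=> d; rewrite /= in_itv /= => dI; apply: contrapT => Cd; apply: H.
  by exists d.
have := countable_lebesgue_measure0 (sub_countable (subset_card_le sub) Cc).
rewrite lebesgue_measure_itv /= lte_fin e0 oppr0 adde0 => -[E].
by rewrite E ltxx in e0.
Qed.

(** * Words along orbits of germs *)

Section Words.
Context {A : choiceType}.
Implicit Types (a : letter A) (w : seq (letter A)).

Definition fg_letter a : freegroup A := @FreeGroup A [:: a] isT.

Lemma fg_letter_inv a : fg_letter (letter_inv a) = (fg_letter a)^-1%g.
Proof. exact/val_inj. Qed.

Lemma fg_letter_cons a (x : freegroup A) : reduced (a :: fg_word x) ->
  fg_word (fg_letter a * x)%g = a :: fg_word x.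
Proof. by case: x => [[//|b w] /= r] /= /andP[/negbTE-> _]. Qed.

Lemma fg_ind (P : freegroup A -> Prop) :
  P 1%g -> (forall a x, P x -> P (fg_letter a * x)%g) -> forall x, P x.
Proof.
move=> P1 PS [w rw]; elim: w rw => [|a w IH] rw.
  by rewrite (_ : FreeGroup rw = 1%g) //; exact/val_inj.
have rw' : reduced w by exact: reduced_behead rw.
rewrite (_ : FreeGroup rw = fg_letter a * FreeGroup rw')%g; first exact/PS/IH.
by apply/val_inj; rewrite [RHS]fg_letter_cons.
Qed.

Lemma fg_neqV (x : freegroup A) : x <> 1%g -> x <> (x^-1)%g.
Proof.
move=> x1 /(congr1 (@fg_word A)) /= E; apply: x1.
(* In a word equal to its inverse the end letters are mutually inverse and the middle is again equal
   to its inverse; by induction the middle is empty, and the word is not reduced. *)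
suff K (w : seq (letter A)) : reduced w -> w = word_inv w -> w = [::].
  by apply/val_inj/K => //; exact: fg_reduced.
have [n] := ubnP (size w); elim: n w => [//|n IH] w; rewrite ltnS.
case: w => [//|a w]; case: (lastP w) => [_ _|{}w b].
  rewrite /word_inv /= => -[] /(congr1 snd) /=; by case: (a.2).
move=> /= le_n r; rewrite /word_inv /= map_rcons rev_cons rev_rcons => -[Ea].
move/rcons_inj => [Ew Eb].
have rw : reduced w.
  by move: r; rewrite /reduced /= rcons_path => /andP[/path_sorted].
have w0 : w = [::] by apply: IH => //; rewrite size_rcons in le_n; exact: ltnW.
by move: r; rewrite w0 /= Eb eqxx.
Qed.

End Words.

Section GermWords.
Context {R : realType} {A : finType} (T : linear_involution R A) (a0 : letter A).
Implicit Types (a b : letter A) (z : Defs.point R) (g : germ R) (d t : R).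

Local Notation germ_letter := (germ_letter T a0).
Local Notation germ_map := (germ_map T a0).
Local Notation germ_iter := (germ_iter T a0).
Local Notation germ_room := (germ_room T a0).
Local Notation germ_valid := (germ_valid T).

Fixpoint germ_word n g : freegroup A :=
  if n is n'.+1 then (fg_letter (germ_letter g) * germ_word n' (germ_map g))%g
  else 1%g.

Lemma germ_wordD m n g :
  germ_word (m + n) g = (germ_word m g * germ_word n (germ_iter m g))%g.
Proof.
elim: m g => [|m IH] g; first by rewrite add0n /= mul1g.
by rewrite addSn /= IH -germ_iterSr mulgA.
Qed.

Lemma germ_wordSr n g :
  germ_word n.+1 g = (germ_word n g * fg_letter (germ_letter (germ_iter n g)))%g.
Proof. by rewrite -addn1 germ_wordD /= mulg1. Qed.

Lemma germ_word_ext n g h :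
  (forall i, (i < n)%N -> germ_letter (germ_iter i g) = germ_letter (germ_iter i h)) ->
  germ_word n g = germ_word n h.
Proof.
elim: n => [//|n IH] E; rewrite !germ_wordSr E // IH // => i ltin.
exact/E/ltnW.
Qed.

Lemma germ_word_rev n g : germ_valid g ->
  germ_word n (germ_rev (germ_iter n g)) = (germ_word n g)^-1%g.
Proof.
move=> gv; elim: n => [|n IH]; first by rewrite /= invg1.
have iv := germ_iter_valid a0 n gv.
rewrite [in RHS]germ_wordSr invgM -IH -fg_letter_inv -germ_letter_rev //=.
by rewrite -/(germ_iter n g) germ_map_rev.
Qed.

(** [sigma_2] moves the germ off the level of the interval of the inverse letter. *)
Lemma germ_letter_neq g : germ_valid g ->
  germ_letter (germ_map g) != letter_inv (germ_letter g).
Proof.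
move=> gv; apply/eqP => E.
have /andP[/eqP + _] := germ_letterP a0 (germ_map_valid a0 gv).
by rewrite E /= /li_move /=; case: (li_level _ _).
Qed.

Lemma germ_wordE n g : germ_valid g ->
  fg_word (germ_word n g) = mkseq (fun i => germ_letter (germ_iter i g)) n.
Proof.
elim: n g => [//|n IH] g gv; rewrite /mkseq /= (iotaDl 1) -map_comp.
have mv := germ_map_valid a0 gv.
have E : [seq ((fun i => germ_letter (germ_iter i g)) \o addn 1) i | i <- iota 0 n]
   = fg_word (germ_word n (germ_map g)).
  by rewrite IH //; apply: eq_map => i /=; rewrite -germ_iterSr.
rewrite E; apply: fg_letter_cons.
have := fg_reduced (germ_word n (germ_map g)).
rewrite IH //; case: n {IH E} => [//|n]; rewrite /mkseq /= => ->.
by rewrite andbT germ_letter_neq.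
Qed.

Lemma germ_word_size n g : germ_valid g -> size (fg_word (germ_word n g)) = n.
Proof. by move=> gv; rewrite germ_wordE // size_mkseq. Qed.

Lemma germ_word_prefix n g (x : freegroup A) : germ_valid g ->
  prefix (fg_word x) (fg_word (germ_word n g)) ->
  exists2 i, (i <= n)%N & x = germ_word i g.
Proof.
move=> gv px.
have le_n : (size (fg_word x) <= n)%N.
  by rewrite -(germ_word_size n gv); exact: size_prefix.
exists (size (fg_word x)) => //.
apply/val_inj; change (fg_word x = fg_word (germ_word (size (fg_word x)) g)).
rewrite [RHS]germ_wordE //; move: px; rewrite prefixE => /eqP {1}<-.
by rewrite germ_wordE // /mkseq -map_take take_iota (minn_idPl le_n).
Qed.

Lemma li_O_countable : countable (li_O T).
Proof.
(* Time reversal recovers a point from a time and the division point that it reaches at that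
   time. *)
pose f (p : nat * 'I_(#|A|.*2)) : Defs.point R :=
  li_sigma2 (odflt (0, false)
    (li_iter T p.1 (li_sigma2 (li_start T (li_perm T p.2), li_row T p.2)))).
apply: (@sub_countable _ _ _ (range f)); last first.
  by apply: (sub_countable (card_image_le _ _)); exact: countableP.
apply: subset_card_le => z [n [y [i [j [_ _ ->]]] zy]]; exists (n, j) => //.
by rewrite /f /= (li_iter_rev a0 zy) /= li_sigma2K.
Qed.

Lemma li_Ohat_countable : countable (li_Ohat T).
Proof.
have -> : li_Ohat T = \bigcup_(b in [set: bool])
    (if b then li_O T else [set li_sigma2 z | z in li_O T]).
  apply/seteqP; split=> z; first by case=> zO; [exists true|exists false].
  by case=> -[] _ zO; [left|right].
apply: bigcup_countable => [|[] _]; first exact: countableP.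
  exact: li_O_countable.
by apply: (sub_countable (card_image_le _ _)); exact: li_O_countable.
Qed.

Lemma li_orbit_generic z n : li_Ihat T z -> ~ li_O T z ->
  li_iter T n z = Some (germ_iter n (z, false)).1 /\
  li_interval T (germ_letter (germ_iter n (z, false))) (germ_iter n (z, false)).1.
Proof.
move=> zI zO; have gi : germ_interior T (z, false) by [].
have [[_ [_ [gin E]]]|[i [y [_ Sy iy]]]] := germ_opp_iter a0 n gi; last first.
  by case: zO; exists i, y.
split=> //; have [//|_] := @germ_opp_in _ _ T a0 _ gin; last by [].
by move=> S; apply: zO; exists n, (germ_iter n (z, false)).1.
Qed.

(** A small shift in the direction of the germ avoids the countable exceptional set and reads the
    same first [n] letters. *)
Lemma germ_word_coding n g : germ_valid g ->
  natural_coding_fg T (germ_word n g).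
Proof.
(* One room more than the word needs, so that the first one is controlled even for [n] equal to
   0. *)
move=> gv; have [eps e0 epsP] := germ_room_iter_bound a0 n.+1 gv.
pose z d : Defs.point R := (germ_shift g d false).1.
have zc : countable [set d | li_Ohat T (z d)].
  have /countable_injP[f fi] := li_Ohat_countable; apply/countable_injP.
  exists (f \o z) => d1 d2; rewrite !inE => O1 O2 /fi; rewrite !inE => /(_ O1 O2).
  by rewrite /z /germ_shift /= => -[]; case: (g.2) => [/addrI/oppr_inj|/addrI].
have [d /andP[d0 de] nO] := countable_avoid zc e0.
have room i : (i < n.+1)%N -> d < germ_room (germ_iter i g).
  by move=> /epsP; exact: lt_le_trans.
(* The flip by [g.2] gives a right germ whatever the side of [g]. *)
have zE : (z d, false) = germ_shift g d g.2.
  by rewrite /z /germ_shift /= addbb.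
have zI : li_Ihat T (z d).
  have vf : germ_valid (germ_shift g d false).
    by apply: germ_shift_valid (room 0%N isT) => //; exact: ltW.
  have vt : germ_valid (germ_shift g d true).
    by apply: germ_shift_valid (room 0%N isT) => //; exact: ltW.
  move: vf vt; rewrite /z /li_Ihat /germ_shift /germ_valid /=.
  by case: (g.2) => /= /andP[? ?] /andP[? ?]; apply/andP; split.
have zO : ~ li_O T (z d) by move=> ?; apply: nO; left.
have orb m := li_orbit_generic m zI zO.
exists (z d), (fun i => germ_letter (germ_iter i (z d, false))), 0%N, n.
split=> //.
  by move=> m; exists (germ_iter m (z d, false)).1; have [] := orb m.
rewrite germ_wordE //; apply/eq_in_map => i; rewrite mem_iota add0n => /andP[_ ltin].
have [L _] := germ_shift_iter gv (ltW d0) (fun _ : g.2 => d0) room.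
by rewrite add0n zE L // ltnW.
Qed.

Lemma coding_germ_word x : natural_coding_fg T x ->
  exists g n, germ_valid g /\ x = germ_word n g.
Proof.
move=> [z [u [p [n [_ codes xE]]]]].
have [z' pz' Iz'] := codes p; exists (z', false), n.
have gv := germ_in_valid (li_interval_germ false Iz'); split=> //.
have orb i : exists2 zi, li_iter T (p + i) z = Some zi & zi =
  (germ_iter i (z', false)).1.
  elim: i => [|i [zi E zE]]; first by rewrite addn0; exists z'.
  have [y] := codes (p + i)%N; rewrite E => -[<-] Ii.
  rewrite addnS li_iterS E /= (li_map_germ a0 (germ_iter i (z', false)).2 Ii).
  by rewrite zE -surjective_pairing; eexists.
apply/val_inj; change (fg_word x = fg_word (germ_word n (z', false))).
rewrite xE [RHS]germ_wordE //; apply: eq_map => i.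
have [zi E zE] := orb i; have [y] := codes (p + i)%N; rewrite E => -[<-].
rewrite zE => Ii; apply/esym/(@germ_letterE _ _ T).
by rewrite [germ_iter _ _]surjective_pairing; exact: li_interval_germ.
Qed.

End GermWords.

Lemma pigeonhole (U : Type) (C : set U) (f : nat -> U) (P : set nat) :
  finite_set C -> (forall n, C (f n)) ->
  (forall N, exists2 n, (N <= n)%N & P n) ->
  exists n m, [/\ (n < m)%N, P n, P m & f n = f m].
Proof.
move=> fC Cf infP; apply: contrapT => H.
have fi : {in P &, injective f}.
  move=> n m; rewrite !inE => Pn Pm E; case: (ltngtP n m) => [lt|lt|//]; case: H.
    by exists n, m.
  by exists m, n.
have : finite_set P.
  rewrite -(eq_finite_set (inj_card_eq fi)).
  by apply: sub_finite_set fC => _ [n _ <-].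
move=> /finite_seqP[s Ps]; have [n lt_n] := infP (\max_(i <- s) i).+1.
by rewrite Ps /= => ns; have := @leq_bigmax_seq _ s xpredT id n ns isT;
  rewrite leqNgt lt_n.
Qed.

(** * Compactness of segments of germs *)

Section Cousin.
Context {R : realType}.
Implicit Types (l r t x y z eps : R) (s : bool).

(** The germs that look into the segment; adjacent segments share a point but no germ. *)
Definition in_seg x y t s : bool := if s then x < t <= y else x <= t < y.

Lemma in_seg_split x y z t s : in_seg x z t s -> in_seg x y t s || in_seg y z t s.
Proof.
rewrite /in_seg; case: s => /andP[xt tz].
  by case: (leP t y) => ty; rewrite ?xt ?tz ?orbT.
by case: (ltP t y) => ty; rewrite ?xt ?tz ?orbT.
Qed.

(** The supremum of the points reached from [l] is itself reached, by locality at its left germ;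
    locality at its right germ would pass beyond it if it were less than [r]. *)
Lemma cousin l r (Good : R -> R -> Prop) : l < r ->
  (forall x y z, l <= x -> x < y -> y < z -> z <= r ->
     Good x y -> Good y z -> Good x z) ->
  (forall t s, in_seg l r t s -> exists2 eps, 0 < eps &
     forall x y, l <= x -> x < y -> y <= r -> y - x < eps ->
       t = (if s then y else x) -> Good x y) ->
  Good l r.
Proof.
move=> lr comp loc; pose S := [set y | l < y <= r /\ Good l y].
have S0 : S !=set0.
  have [|eps e0 epsP] := loc l false; first by rewrite /in_seg lexx.
  pose y := Num.min r (l + eps / 2); exists y.
  have ly : l < y by rewrite lt_min lr /=; lra.
  have yr : y <= r by rewrite ge_min lexx.
  have ye : y <= l + eps / 2 by rewrite ge_min lexx orbT.
  by split; [rewrite ly|apply: epsP => //; lra].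
have hS : has_sup S by split=> //; exists r => y [/andP[]].
have leS y : S y -> y <= sup S by move=> Sy; exact: (ub_le_sup hS.2).
have lsup : l < sup S by have [y Sy] := S0; have [/andP[+ _] _] := Sy;
  move/lt_le_trans; apply; exact: leS.
have supr : sup S <= r by apply: ge_sup => // y [/andP[]].
have Gs : Good l (sup S).
  have [|eps e0 epsP] := loc (sup S) true; first by rewrite /in_seg lsup.
  have [y Sy ye] := sup_adherent e0 hS.
  have [/andP[ly yr] Gy] := Sy; have := leS _ Sy;
    rewrite le_eqVlt => /predU1P[<- //|ys].
  by apply: (comp l y) => //; apply: epsP => //; [exact: ltW|lra].
move: supr; rewrite le_eqVlt => /predU1P[<- //|supr].
have [|eps e0 epsP] := loc (sup S) false; first by rewrite /in_seg (ltW lsup).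
pose y := Num.min r (sup S + eps / 2).
have sy : sup S < y by rewrite lt_min supr /=; lra.
have yr : y <= r by rewrite ge_min lexx.
have ye : y <= sup S + eps / 2 by rewrite ge_min lexx orbT.
suff /leS : S y by rewrite leNgt sy.
split; first by rewrite (lt_trans lsup sy).
apply: (comp l (sup S)) => //; apply: epsP => //; [exact: ltW|lra].
Qed.

(** Turns local statements about shifts of a germ into statements about short segments that end at
    it. *)
Lemma seg_shift x y (s s' d : bool) (t' : R) : in_seg x y t' s' ->
  exists2 u, [/\ 0 <= u, s (+) s' -> 0 < u & u <= y - x] &
    ((t', d), s') = germ_shift ((if s then y else x, d), s) u (s (+) s').
Proof.
rewrite /in_seg /germ_shift /=; case: s; case: s' => /= /andP[? ?].
- by exists (y - t'); [split=> //; lra|congr (_, _, _); ring].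
- by exists (y - t'); [split=> // *; lra|congr (_, _, _); ring].
- by exists (t' - x); [split=> // *; lra|congr (_, _, _); ring].
- by exists (t' - x); [split=> //; lra|congr (_, _, _); ring].
Qed.

End Cousin.

Section Subgroup.
Context {F : groupType} (G : set F) (Gs : is_subgroup G).
Implicit Types x y : F.

Lemma subgroup1 : G 1%g.
Proof. by have [/set_mem] := Gs. Qed.

Lemma subgroupV x : G x -> G (x^-1)%g.
Proof. by move=> /mem_set /(group_closedV Gs)/set_mem. Qed.

Lemma subgroupM x y : G x -> G y -> G (x * y)%g.
Proof. by move=> /mem_set xG /mem_set yG; apply: set_mem;
  exact: (group_closedM Gs). Qed.

Lemma subgroupMl x y : G x -> G (x * y)%g <-> G y.
Proof.
move=> Gx; split; last exact: subgroupM.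
by move=> Gxy; rewrite -(mulKg x y); apply: subgroupM => //; exact: subgroupV.
Qed.

Lemma subgroup_coset x y :
  [set (x^-1 * h)%g | h in G] = [set (y^-1 * h)%g | h in G] -> G (y * x^-1)%g.
Proof.
move=> E; have : [set (x^-1 * h)%g | h in G] (x^-1)%g.
  by exists 1%g; [exact: subgroup1|rewrite mulg1].
by rewrite E => -[h Gh <-]; rewrite mulgA mulgV mul1g.
Qed.

End Subgroup.

(** * Recurrence *)

Section Recurrence.
Context {R : realType} {A : finType} (T : linear_involution R A) (a0 : letter A).
Context (G : set (freegroup A)) (Gs : is_subgroup G).
Implicit Types (a b : letter A) (g : germ R) (d t : R) (h : freegroup A).

Local Notation germ_letter := (germ_letter T a0).
Local Notation germ_iter := (germ_iter T a0).
Local Notation germ_room := (germ_room T a0).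
Local Notation germ_valid := (germ_valid T).
Local Notation germ_word := (germ_word T a0).

(** The right coset of [h] is represented by its image under inversion, because [finite_index]
    counts left cosets. *)
Let coset h := [set (h^-1 * k)%g | k in G].

Lemma germ_shift0 g : germ_shift g 0 false = g.
Proof. by case: g => [[t s] e]; rewrite /germ_shift /= oppr0 if_same addr0 addbF. Qed.

(** Injectivity cancels [n] steps, so the germ shifted by [d'] reaches in [m - n] steps the one
    shifted by [d]. Shifts read the words of [g], hence the word of length [m] is that of length
    [m - n] times that of length [n]. *)
Lemma germ_return_coincidence g n m d d' : germ_valid g -> (n < m)%N ->
  0 <= d < germ_room g -> 0 <= d' < germ_room g ->
  (forall i, (i < n)%N -> d < germ_room (germ_iter i g)) ->
  (forall i, (i < m)%N -> d' < germ_room (germ_iter i g)) ->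
  germ_iter n (germ_shift g d false) = germ_iter m (germ_shift g d' false) ->
  coset (germ_word n g) = coset (germ_word m g) -> G (germ_word (m - n) g).
Proof.
move=> gv ltnm /andP[d0 dr] /andP[d'0 d'r] rd rd' E /(subgroup_coset Gs).
have [L _] := germ_slide_iter gv d0 rd.
have [L' _] := germ_slide_iter gv d'0 rd'.
have v : germ_valid (germ_shift g d false) by exact: germ_shift_valid dr.
have v' : germ_valid (germ_shift g d' false) by exact: germ_shift_valid d'r.
have mE : m = (n + (m - n))%N by rewrite subnKC // ltnW.
have mE' : m = (m - n + n)%N by rewrite subnK // ltnW.
have E' : germ_shift g d false = germ_iter (m - n) (germ_shift g d' false).
  apply: (germ_iter_inj (a0 := a0) (n := n) v); first exact: germ_iter_valid.
  by rewrite -germ_iterD -mE.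
have W : germ_word m g = (germ_word (m - n) g * germ_word n g)%g.
  rewrite -(germ_word_ext L') {1}mE' germ_wordD -E' (germ_word_ext L).
  congr (_ * _)%g; apply: germ_word_ext => i lti; apply: L'.
  by apply: leq_trans lti _; exact: leq_subr.
by rewrite W mulgK.
Qed.

Lemma germ_return : finite_index G -> forall g, germ_valid g ->
  exists2 n, (0 < n)%N & G (germ_word n g).
Proof.
move=> Gf g gv.
have [[eps e0 epsP]|H] :=
  pselect (exists2 eps, 0 < eps & forall i, eps <= germ_room (germ_iter i g)).
- (* Two germs of the orbit in the same coset at distance less than eps: going
     back along the orbit, one of them is a shift of g itself. *)
  pose cell i := Num.truncn (((germ_iter i g).1.1 - li_left T) / eps).
  pose K := (Num.truncn ((li_right T - li_left T) / eps)).+1.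
  pose f i := ((cell i, ((germ_iter i g).1.2, (germ_iter i g).2)), coset (germ_word i
    g)).
  have tI i : li_left T <= (germ_iter i g).1.1 <= li_right T.
    have := germ_iter_valid a0 i gv; rewrite /germ_valid.
    by case: ifP => _ /andP[? ?]; apply/andP; split; lra.
  have fC i : ((`I_K `*` [set: bool * bool]) `*` [set C | exists x, C =
    [set (x * h)%g | h in G]]) (f i).
    split; last by exists (germ_word i g)^-1%g.
    split=> //=; rewrite /K ltnS; apply: le_truncn.
    by rewrite ler_pM2r ?invr_gt0 // lerD2r; have /andP[] := tI i.
  have [||i [j [ltij _ _]]] := @pigeonhole _ _ f (fun=> True) _ fC.
  + by apply: finite_setX => //; apply: finite_setX;
    [exact: finite_II|exact: finite_finset].
  + by move=> N; exists N.
  rewrite /f => -[cE dE sE wE].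
  have pos k : 0 <= ((germ_iter k g).1.1 - li_left T) / eps.
    by apply: divr_ge0; rewrite ?subr_ge0; [have /andP[] := tI k|exact: ltW].
  have dist : - eps < (germ_iter j g).1.1 - (germ_iter i g).1.1 < eps.
    have -> : (germ_iter j g).1.1 - (germ_iter i g).1.1 =
        (((germ_iter j g).1.1 - li_left T) / eps - ((germ_iter i g).1.1 - li_left T)
          / eps) * eps.
      by rewrite -mulrBl divfK ?gt_eqF //; ring.
    have := truncn_itv (pos i); have := truncn_itv (pos j).
    rewrite -/(cell i) -/(cell j) cE -natr1.
    move: (cell j)%:R (_ / eps) (_ / eps) => c v w /andP[? ?] /andP[? ?].
    rewrite -{1}[eps]mul1r -mulNr ltr_pM2r // -{2}[eps]mul1r ltr_pM2r //.
    by apply/andP; split; lra.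
  (* How far the germ at time [j] is ahead of the one at time [i], in their common direction; the
     sign decides which visit is shifted. *)
  pose u := if (germ_iter i g).2 then (germ_iter i g).1.1 - (germ_iter j g).1.1
            else (germ_iter j g).1.1 - (germ_iter i g).1.1.
  have ue : - eps < u < eps.
    by rewrite /u; case: ifP => _ //; move: dist => /andP[? ?]; apply/andP; split; lra.
  have gr := germ_room_gt0 a0 gv.
  exists (j - i)%N; first by rewrite subn_gt0.
  have [u0|u0] := leP 0 u.
    have ur k : u < germ_room (germ_iter k g).
      by apply: lt_le_trans (epsP k); have /andP[] := ue.
    apply: (@germ_return_coincidence g i j u 0) => //.
    + by rewrite u0 (ur 0%N).
    + by rewrite lexx.
    + by move=> k _; exact: germ_room_gt0 (germ_iter_valid _ _ _).
    have [_ ->//] := germ_slide_iter gv u0 (fun k (_ : (k < i)%N) => ur k).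
    rewrite germ_shift0; move: dE sE; rewrite /u /germ_shift.
    case: (germ_iter i g) => [[t1 s1] e1];
      case: (germ_iter j g) => [[t2 s2] e2] /= -> ->.
    by case: e2; congr (_, _, _); ring.
  have u0' : 0 <= - u by lra.
  have ur k : - u < germ_room (germ_iter k g).
    by apply: lt_le_trans (epsP k); have /andP[? ?] := ue; lra.
  apply: (@germ_return_coincidence g i j 0 (- u)) => //.
  + by rewrite lexx.
  + by rewrite u0' (ur 0%N).
  + by move=> k _; exact: germ_room_gt0 (germ_iter_valid _ _ _).
  have [_ ->//] := germ_slide_iter gv u0' (fun k (_ : (k < j)%N) => ur k).
  rewrite germ_shift0; move: dE sE; rewrite /u /germ_shift.
  case: (germ_iter i g) => [[t1 s1] e1]; case: (germ_iter j g) => [[t2 s2] e2] /= -> ->.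
  by case: e2; congr (_, _, _); ring.
- (* At a new minimum of the room, the interval that follows the orbit reaches a
     division point; two such visits to the same one in the same coset coincide
     after going back along the orbit. *)
  (* Time 0 is excluded, so that the room at a record is less than that of [g] itself. *)
  pose record n := (0 < n)%N /\ forall i, (i < n)%N ->
    germ_room (germ_iter n g) < germ_room (germ_iter i g).
  pose f i := ((germ_letter (germ_iter i g), ((germ_iter i g).1.2, (germ_iter i
    g).2)), coset (germ_word i g)).
  have fC i : ([set: letter A * (bool * bool)] `*` [set C | exists x, C =
    [set (x * h)%g | h in G]]) (f i).
    by split=> //; exists (germ_word i g)^-1%g.
  have [||n [m [ltnm [n0 Rn] [m0 Rm]]]] := @pigeonhole _ _ f record _ fC.
  + by apply: finite_setX => //; exact: finite_finset.
  + move=> N; have [eps e0 epsP] := germ_room_iter_bound a0 N.+1 gv.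
    have exi : exists i, germ_room (germ_iter i g) < eps.
      apply: contrapT => nex; apply: H; exists eps => // i; rewrite leNgt;
        apply/negP => ?.
      by apply: nex; exists i.
    (* The first index with room below [eps] is a record, and it exceeds [N] because [eps] bounds
       the first [N.+1] rooms from below. *)
    case: (ex_minnP exi) => n ne nmin; have ltNn : (N < n)%N.
      by rewrite ltnNge; apply/negP => /epsP; rewrite leNgt ne.
    exists n; first exact: ltnW.
    split; first exact: leq_ltn_trans ltNn.
    move=> i ltin; apply: (lt_le_trans ne); rewrite leNgt; apply/negP => /nmin.
    by rewrite leqNgt ltin.
  rewrite /f => -[lE dE sE wE]; exists (m - n)%N; first by rewrite subn_gt0.
  have rn := germ_room_gt0 a0 (germ_iter_valid a0 n gv).
  have rm := germ_room_gt0 a0 (germ_iter_valid a0 m gv).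
  apply: (@germ_return_coincidence g n m (germ_room (germ_iter n g)) (germ_room
    (germ_iter m g))) => //.
  + by apply/andP; split; [exact: ltW|exact: (Rn 0%N)].
  + by apply/andP; split; [exact: ltW|exact: (Rm 0%N)].
  (* Shifting by the whole room puts both visits at the far end of the interval of their common
     letter. *)
  have [_ ->//] := germ_slide_iter gv (ltW rn) Rn.
  have [_ ->//] := germ_slide_iter gv (ltW rm) Rm.
  move: lE dE sE; rewrite /germ_room.
  case: (germ_iter n g) => [[t1 s1] e1];
    case: (germ_iter m g) => [[t2 s2] e2] /= -> -> ->.
  by rewrite /germ_shift /=; case: e2; congr (_, _, _); ring.
Qed.

End Recurrence.

(** * First hits and generation *)

Section Hitting.
Context {R : realType} {A : finType} (T : linear_involution R A) (a0 : letter A).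
Context (G : set (freegroup A)) (Gs : is_subgroup G) (Gf : finite_index G).
Context (nc : without_connection T).
Implicit Types (a b : letter A) (g : germ R) (d t : R) (h : freegroup A).

Local Notation germ_letter := (germ_letter T a0).
Local Notation germ_map := (germ_map T a0).
Local Notation germ_iter := (germ_iter T a0).
Local Notation germ_room := (germ_room T a0).
Local Notation germ_valid := (germ_valid T).
Local Notation germ_word := (germ_word T a0).

Lemma germ_near g n : germ_valid g -> exists2 eps, 0 < eps &
  forall d (e : bool), 0 <= d -> (e -> 0 < d) -> d < eps ->
    [/\ germ_letter (germ_shift g d e) = germ_letter g,
        germ_map (germ_shift g d e) = germ_shift (germ_map g) d e &
        forall i, (i <= n)%N -> germ_word i (germ_shift g d e) = germ_word i g].
Proof.
move=> gv; have [eps e0 epsP] := germ_room_iter_bound a0 n.+1 gv.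
exists eps => // d e d0 ed de.
have room i : (i < n.+1)%N -> d < germ_room (germ_iter i g).
  by move=> /epsP; exact: lt_le_trans.
have [-> ->] := germ_shift_map gv d0 ed (room 0%N isT).
have [L _] := germ_shift_iter gv d0 ed room.
split=> // i lein; apply: germ_word_ext => j ltji; apply: L.
by rewrite ltnS ltnW // (leq_trans ltji).
Qed.

(** A return time of one germ serves for a one-sided neighbourhood of it; compactness does the
    rest. *)
Lemma germ_return_bounded : exists N, forall g, germ_valid g ->
  exists2 n, (0 < n <= N)%N & G (germ_word n g).
Proof.
have lr := li_left_right T.
suff B s : exists N, forall t e, in_seg (li_left T) (li_right T) t e ->
    exists2 n, (0 < n <= N)%N & G (germ_word n (t, s, e)).
  have [N HN] := B true; have [N' HN'] := B false.
  exists (maxn N N') => -[[t s] e] gv.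
  case: s gv => gv; [have [n /andP[n0 nN] Gn] :=
    HN t e gv|have [n /andP[n0 nN] Gn] := HN' t e gv].
    by exists n => //; rewrite n0 leq_max nN.
  by exists n => //; rewrite n0 leq_max nN orbT.
pose Good x y := exists N, forall t e, in_seg x y t e ->
    exists2 n, (0 < n <= N)%N & G (germ_word n (t, s, e)).
apply: (@cousin _ _ _ Good) => //.
  move=> x y z _ _ _ _ [N HN] [N' HN'];
    exists (maxn N N') => t e /(@in_seg_split _ x y z)/orP[] I.
    have [n /andP[n0 nN] Gn] := HN _ _ I.
    by exists n => //; rewrite n0 leq_max nN.
  have [n /andP[n0 nN] Gn] := HN' _ _ I.
  by exists n => //; rewrite n0 leq_max nN orbT.
move=> t e I; have gv : germ_valid (t, s, e) by [].
have [n n0 Gn] := germ_return a0 Gs Gf gv.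
have [eps e0 epsP] := germ_near n gv; exists eps => // x y _ _ _ xye tE.
exists n => t' e' /(seg_shift e s)[u [u0 eu uxy]]; rewrite -tE => ->.
by exists n; rewrite ?n0 ?leqnn //; have [_ _ ->] :=
  epsP u _ u0 eu (le_lt_trans uxy xye).
Qed.

(** The pair of [h] and [g] is a point of the skew product, where reading [w] moves [h] to [h * w].
    A hit may occur at time 0, a return may not. *)
Definition first_hit h g n : Prop :=
  G (h * germ_word n g)%g /\ forall i, (i < n)%N -> ~ G (h * germ_word i g)%g.

Definition first_return h g n : Prop :=
  [/\ (0 < n)%N, G (h * germ_word n g)%g &
    forall i, (0 < i < n)%N -> ~ G (h * germ_word i g)%g].

Lemma first_return_ex h g : germ_valid g ->
  (exists2 n, (0 < n)%N & G (h * germ_word n g)%g) ->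
  exists n, first_return h g n.
Proof.
move=> gv [n n0 Gn].
have ex : exists n, (0 < n)%N && `[< G (h * germ_word n g)%g >].
  by exists n; rewrite n0; apply/asboolP.
case: (ex_minnP ex) => m /andP[m0 /asboolP Gm] mmin; exists m;
  split=> // i /andP[i0 im] Gi.
by have := mmin i; rewrite i0 leqNgt im => /(_ (introT (asboolP _) Gi)).
Qed.

(** Prefixes of the word are read along the same orbit in shorter time, so primality is minimality
    of the return time. *)
Lemma prime_first_return h g n : germ_valid g -> G h -> first_return h g n ->
  prime_words (natural_coding_fg T) G (germ_word n g).
Proof.
move=> gv Gh [n0 /(subgroupMl Gs _ Gh) Gn nG]; split.
- by split=> //; exact: germ_word_coding.
- by move=> /(congr1 size); rewrite germ_word_size // => n00; rewrite n00 in n0.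
move=> x [Gx _] x1 /(germ_word_prefix gv)[i lein xE].
move: lein; rewrite leq_eqVlt => /predU1P[<- //|ltin]; case: (nG i).
  by rewrite ltin andbT lt0n; apply/eqP => i0; apply: x1; rewrite xE i0.
by apply/(subgroupMl Gs) => //; rewrite -xE.
Qed.

Lemma first_return_prime x : prime_words (natural_coding_fg T) G x ->
  exists g n, [/\ germ_valid g, first_return 1%g g n & x = germ_word n g].
Proof.
move=> [[Gx /(coding_germ_word a0)[g [n [gv xE]]]] x1 xmin]; exists g, n; split=> //.
split; rewrite ?mul1g -?xE //.
  by rewrite lt0n; apply/eqP => n0; apply: x1; rewrite xE n0.
move=> i /andP[i0 ltin]; rewrite mul1g => Gi.
have sz k := germ_word_size a0 k gv.
have E : germ_word i g = x.
  apply: xmin; first by split=> //; exact: germ_word_coding.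
    by move=> /(congr1 size); rewrite sz => ii; rewrite ii in i0.
  rewrite xE prefixE sz !germ_wordE // /mkseq -map_take take_iota (minn_idPl _) //.
  exact: ltnW.
by have := sz i; rewrite E xE sz => ii; rewrite ii ltnn in ltin.
Qed.

Lemma first_hit_gt0 h g n : ~ G h -> first_hit h g n -> (0 < n)%N.
Proof. by case: n => [|//] nGh [+ _]; rewrite /= mulg1. Qed.

(* The reversed orbit from the end of a hitting path retraces it. *)
Lemma retrace_word g m i : germ_valid g ->
  germ_word (m + i) (germ_rev (germ_iter m (germ_rev g))) =
  ((germ_word m (germ_rev g))^-1 * germ_word i g)%g.
Proof.
move=> gv; rewrite germ_wordD germ_word_rev // germ_iter_rev //.
by rewrite germ_revK.
Qed.

Lemma retrace_word_le g m i : germ_valid g -> (i <= m)%N ->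
  (germ_word m (germ_rev g) * germ_word i (germ_rev (germ_iter m (germ_rev g))))%g =
  germ_word (m - i) (germ_rev g).
Proof.
move=> gv leim; have gv' : germ_valid (germ_iter (m - i) (germ_rev g)).
  exact: germ_iter_valid.
have -> : germ_iter m (germ_rev g) = germ_iter i (germ_iter (m - i) (germ_rev g)).
  by rewrite -germ_iterD subnKC.
rewrite germ_word_rev // -{1}(subnK leim) germ_wordD.
by rewrite mulgK.
Qed.

Lemma first_hit_through h g m i : germ_valid g ->
  first_hit h (germ_rev g) m -> (0 < i <= m)%N ->
  ~ G (h * germ_word m (germ_rev g) * germ_word i (germ_rev (germ_iter m (germ_rev
    g))))%g.
Proof.
move=> gv [_ nG] /andP[i0 im]; rewrite -mulgA retrace_word_le //.
by apply: nG; rewrite -subn_gt0 subKn.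
Qed.

Lemma first_hit_return h g m n : germ_valid g -> ~ G h ->
  first_hit h (germ_rev g) m -> first_hit h g n ->
  first_return (h * germ_word m (germ_rev g))%g
    (germ_rev (germ_iter m (germ_rev g))) (m + n).
Proof.
move=> gv nGh hm hn; split.
- by rewrite addn_gt0 (first_hit_gt0 nGh hm).
- rewrite retrace_word // -mulgA mulVKg; exact: hn.1.
move=> i /andP[i0 imn]; have [im|im] := leqP i m.
  by apply: first_hit_through => //; rewrite i0.
rewrite -(subnKC (ltnW im)) retrace_word // -mulgA mulVKg.
by apply: hn.2; rewrite ltn_subLR // ltnW.
Qed.

Lemma first_return_unique h g n m :
  first_return h g n -> first_return h g m -> n = m.
Proof.
move=> [n0 Gn nGn] [m0 Gm nGm]; case: (ltngtP n m) => // nm.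
  by case: (nGm n); rewrite ?n0.
by case: (nGn m); rewrite ?m0.
Qed.

Context (H : set (freegroup A)) (Hs : is_subgroup H).
Context (XH : prime_words (natural_coding_fg T) G `<=` H).

Definition hits h g : Prop := exists2 n, first_hit h g n & H (h * germ_word n g)%g.

Lemma hits0 h g : G h -> hits h g <-> H h.
Proof.
move=> Gh; split=> [[[|n] [_ nG] Hn]|Hh]; first by rewrite mulg1 in Hn.
  by case: (nG 0%N) => //; rewrite mulg1.
by exists 0%N; rewrite ?mulg1 //; split; rewrite ?mulg1.
Qed.

(** From the hit of the past, the orbit returns to G along a prime word, which lies in H; its start
    is in H, hence also its end, the hit of the future. *)
Lemma hits_complete h g m : germ_valid g -> ~ G h ->
  first_hit h (germ_rev g) m -> H (h * germ_word m (germ_rev g))%g -> hits h g.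
Proof.
move=> gv nGh hm; set k := (h * _)%g => Hk.
set g' := germ_rev (germ_iter m (germ_rev g)).
have gv' : germ_valid g' by exact: germ_iter_valid.
have Gk : G k := hm.1.
have [|n rn] := @first_return_ex k g' gv'.
  have [n n0 Gn] := germ_return a0 Gs Gf gv'.
  by exists n => //; exact: subgroupM.
have Hn : H (k * germ_word n g')%g.
  by apply: subgroupM => //; apply: XH; exact: prime_first_return rn.
(* No return can occur while the past is being retraced. *)
have ltmn : (m < n)%N.
  rewrite ltnNge; apply/negP => lenm; case: rn => n0 Gn _.
  by apply: (first_hit_through gv hm _ Gn); rewrite n0.
have E i : (k * germ_word (m + i) g' = h * germ_word i g)%g.
  by rewrite retrace_word // /k -mulgA mulVKg.
exists (n - m)%N; last by rewrite -E subnKC // ltnW.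
split; first by rewrite -E subnKC ?(ltnW ltmn) //; case: rn.
move=> i lti; rewrite -E; case: rn => _ _; apply.
by rewrite -ltn_subRL lti addn_gt0 (first_hit_gt0 nGh hm).
Qed.

(** For [h] in G the hit at time 0 is traded for the first return, whose word is prime; otherwise
    the hit comes one step earlier. *)
Lemma hits_step h g : germ_valid g -> hits h g ->
  hits (h * fg_letter (germ_letter g))%g (germ_map g).
Proof.
move=> gv hg; have [n n0 [nG Gn Hn]] : exists2 n, (0 < n)%N &
    [/\ forall i, (0 < i < n)%N -> ~ G (h * germ_word i g)%g,
     G (h * germ_word n g)%g & H (h * germ_word n g)%g].
  have [Gh|nGh] := pselect (G h).
    have Hh := (hits0 g Gh).1 hg.
    have [|n rn] := @first_return_ex h g gv.
      have [n n0 Gn] := germ_return a0 Gs Gf gv.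
      by exists n => //; exact: subgroupM.
    have [n0 Gn nG] := rn; exists n => //; split=> //.
    by apply: subgroupM => //; apply: XH; exact: prime_first_return rn.
  have [n hn Hn] := hg; exists n; first exact: first_hit_gt0 hn.
  by case: hn => Gn nG; split=> // i /andP[_ /nG].
case: n n0 nG Gn Hn => [//|n] _ nG; rewrite /= !mulgA => Gn Hn.
by exists n => //; split=> // i lti; rewrite -mulgA; exact: (nG i.+1).
Qed.

Lemma hits_step_rev h g : germ_valid g -> hits h g -> hits h (germ_rev g) ->
  hits (h * fg_letter (germ_letter g))%g (germ_rev (germ_map g)).
Proof.
move=> gv hg [n [Gn nG] Hn]; have hs := hits_step gv hg.
have [Gha|nGha] := pselect (G (h * fg_letter (germ_letter g))%g).
  by apply/(hits0 _ Gha)/(hits0 _ Gha)/hs.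
have W i : (h * fg_letter (germ_letter g) * germ_word i.+1 (germ_rev (germ_map g))
            = h * germ_word i (germ_rev g))%g.
  by rewrite /= germ_letter_rev // germ_map_rev // fg_letter_inv mulgA mulgK.
exists n.+1; last by rewrite W.
split; first by rewrite W.
by case=> [|i] lti; [rewrite mulg1|rewrite W; exact: nG].
Qed.

Lemma hits_ext h g g' n : first_hit h g n -> H (h * germ_word n g)%g ->
  (forall i, (i <= n)%N -> germ_word i g' = germ_word i g) -> hits h g'.
Proof.
move=> [Gn nG] Hn E; exists n; last by rewrite E.
by split=> [|i lti]; rewrite E //; [exact: nG|exact: ltnW].
Qed.

Lemma hits_opp h g : ~ G h -> germ_interior T g ->
  hits h g -> hits h (germ_rev g) ->
  hits h (germ_opp g) /\ hits h (germ_rev (germ_opp g)).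
Proof.
(* By [germ_cross] the opposite germs share a hit on one side; exchanging [g] and [germ_rev g] makes
   it the future. [hits_complete] then gives the other side. *)
move=> nGh; wlog : g / exists n, [/\ first_hit h g n, H (h * germ_word n g)%g &
   opp_agree T a0 n g].
  move=> wl gi [n hn Hn] [m hm Hm]; have [L|L] := germ_cross a0 n m nc gi.
    by apply: wl => //; [exists n; split|exists n|exists m].
  have [|||? ?] := wl (germ_rev g) _ gi; last by split=> //;
    rewrite -[germ_opp g]germ_revK.
  - by exists m; split.
  - by exists m.
  - by rewrite germ_revK; exists n.
move=> [n [hn Hn L]] gi _ _.
have E i : (i <= n)%N -> germ_word i (germ_opp g) = germ_word i g.
  by move=> lein; apply: germ_word_ext => j ltji; apply: L; exact: leq_trans lein.
split; first exact: hits_ext hn Hn E.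
have ov : germ_valid (germ_opp g) by exact: germ_interior_valid.
apply: (@hits_complete _ _ n) => //; rewrite germ_revK ?E //.
by case: hn => Gn nG; split=> [|i lti]; rewrite E //; [exact: nG|exact: ltnW].
Qed.

Lemma hits_spread h g0 : ~ G h -> germ_valid g0 -> hits h g0 ->
  hits h (germ_rev g0) -> forall g, germ_valid g -> hits h g.
Proof.
move=> nGh gv0 h0 h0r; have lr := li_left_right T.
have [N HN] := germ_return_bounded.
pose AA t e := forall s, hits h (t, s, e).
have AAE s t e : hits h (t, s, e) -> hits h (t, ~~ s, e) -> AA t e.
  by move=> hs hs' s'; case: (eqVneq s' s) => [->//|]; case: s s' hs hs' => -[].
(* The past and the future hit together form a first return, so the uniform bound on return times
   bounds hit times. *)
have bound s t e : germ_valid (t, s, e) -> AA t e ->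
  forall n, first_hit h (t, s, e) n -> (n <= N)%N.
  move=> gv aa n hn; have [m hm Hm] := aa (~~ s).
  have r := @first_hit_return h (t, s, e) m n gv nGh hm hn.
  have gv' : germ_valid (germ_rev (germ_iter m (germ_rev (t, s, e)))) by exact:
    germ_iter_valid.
  have [k /andP[k0 kN] Gk] := HN _ gv'; apply: leq_trans kN;
    apply: leq_trans (leq_addl m n) _.
  rewrite leqNgt; apply/negP => kmn; case: r => _ _ /(_ k); rewrite k0 kmn; apply=> //.
  by apply: subgroupM => //; exact: hm.1.
(* One germ of the segment propagates to all: [hits_opp] crosses common ends, and nearby germs read
   the same words up to time [N]. *)
pose Good x y := (exists t e, in_seg x y t e /\ AA t e) ->
  forall t e, in_seg x y t e -> AA t e.
have : Good (li_left T) (li_right T).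
  apply: cousin => //.
  - move=> x y z lx xy yz zr Gxy Gyz [t [e [I aa]]].
    have cross e' : AA y e' -> AA y (~~ e').
      have gi s : germ_interior T (y, s, e') by rewrite /germ_interior /=
        (le_lt_trans lx xy) (lt_le_trans yz zr).
      by move=> aay s; have [] := hits_opp nGh (gi s) (aay s) (aay (~~ s)).
    have Ixy : in_seg x y y true by rewrite /in_seg xy /=.
    have Iyz : in_seg y z y false by rewrite /in_seg yz lexx.
    have [xyA yzA] : (exists t e, in_seg x y t e /\ AA t e) /\
      (exists t e, in_seg y z t e /\ AA t e).
      have /orP[I'|I'] := in_seg_split y I.
        have aay : AA y true by apply: Gxy => //; exists t, e.
        by split; [exists t, e|exists y, false; split=> //; exact: (cross true)].
      have aay : AA y false by apply: Gyz => //; exists t, e.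
      by split; [exists y, true; split=> //; exact: (cross false)|exists t, e].
    by move=> t' e' /(@in_seg_split _ x y z)/orP[]; [exact: Gxy|exact: Gyz].
  move=> t e I.
  have gv s : germ_valid (t, s, e) by [].
  have [eps1 e1 P1] := germ_near N (gv true); have [eps2 e2 P2] :=
    germ_near N (gv false).
  exists (Num.min eps1 eps2) => [|x y lx xy yr xye tE]; first by rewrite lt_min e1.
  have near s t' e' : in_seg x y t' e' -> forall i, (i <= N)%N ->
      germ_word i (t', s, e') = germ_word i (t, s, e).
    move=> /(seg_shift e s)[u [u0 eu uxy]]; rewrite -tE => ->.
    have := le_lt_trans uxy xye; rewrite lt_min => /andP[u1 u2].
    by case: s; [have [_ _] := P1 u _ u0 eu u1|have [_ _] := P2 u _ u0 eu u2].
  move=> [t1 [e1' [I1 aa1]]] t2 e2' I2 s.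
  have v1 : germ_valid (t1, s, e1').
    by move: I1; rewrite /germ_valid /in_seg /=; case: ifP => _ /andP[? ?];
      apply/andP; split; lra.
  have [n hn Hn] := aa1 s; have nN := bound _ _ _ v1 aa1 _ hn.
  apply: (hits_ext hn Hn) => i lein.
  by rewrite (near _ _ _ I2) ?(near _ _ _ I1) // (leq_trans lein).
move=> good [[t s] e] gv; apply: good => //.
by case: g0 gv0 h0 h0r => [[t0 s0] e0] gv0 h0 h0r; exists t0, e0; split=> //;
  exact: (AAE s0).
Qed.

Lemma hits_all h g : germ_valid g -> hits h g.
Proof.
(* The induction adds letters on the left, whereas steps multiply [h] on the right; hence the
   inverse. *)
suff P (x : freegroup A) : forall g, germ_valid g ->
  hits (x^-1)%g g by rewrite -[h]invgK; exact: P.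
move: x {h g}; apply: fg_ind => [|a x IH] g gv.
  by rewrite invg1; apply/hits0; exact: subgroup1.
rewrite invgM -fg_letter_inv; move: (letter_inv a) => b.
(* A step along any germ of the interval of [b] provides one germ of the new strip, from which the
   property spreads. *)
pose g0 : germ R := (li_start T b, li_level T b, false).
have i0 : germ_in T b g0.
  by rewrite /germ_in /= eqxx lexx ltrDl li_len_gt0.
have v0 := germ_in_valid i0.
have s0 := hits_step v0 (IH _ v0); have s1 :=
  hits_step_rev v0 (IH _ v0) (IH (germ_rev g0) v0).
rewrite (germ_letterE a0 i0) in s0 s1.
have [Gb|nGb] := pselect (G (x^-1 * fg_letter b)%g).
  by apply/(hits0 _ Gb)/(hits0 _ Gb)/s0.
by apply: hits_spread s0 s1 _ gv => //; exact: germ_map_valid.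
Qed.

End Hitting.

(** * Transport across a strip *)

Section Transport.
Context {R : realType} (l r : R) (lr : l < r) {F H : groupType} (eta : F -> H).
Context (etaV : forall x, eta (x^-1)%g = (eta x)^-1%g).
Implicit Types (g : germ R) (f : germ R -> F).

Definition locally_constant (U : Type) (f : germ R -> U) : Prop :=
  forall g, in_seg l r g.1.1 g.2 -> exists2 eps, 0 < eps &
    forall d (e : bool), 0 <= d -> (e -> 0 < d) -> d < eps ->
      in_seg l r (germ_shift g d e).1.1 (germ_shift g d e).2 ->
      f (germ_shift g d e) = f g.

(* u is the future value on one strip and f the word of the next hit of G, so that
   (f (germ_rev g))^-1 * f g is the prime word that crosses the strip along g. *)
Definition transport f (u : germ R -> H) : Prop :=
  [/\ forall g, u g = (u (germ_rev g) * eta ((f (germ_rev g))^-1 * f g))%g,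
      locally_constant u &
      forall g, l < g.1.1 < r -> f (germ_opp g) = f g -> u (germ_opp g) = u g].

Lemma transport_ex f : locally_constant f -> exists u, transport f u.
Proof.
move=> fl.
(* Through [k] the values on level [false] determine those on level [true]; [jump] is the last
   clause of [transport] on both levels. *)
pose k t s := eta ((f (t, true, s))^-1 * f (t, false, s))%g.
pose jump (u : R -> bool -> H) b :=
  (f (b, false, true) = f (b, false, false) -> u b true = u b false) /\
  (f (b, true, true) = f (b, true, false) ->
     (u b true / k b true = u b false / k b false)%g).
pose sh (t : R) (s : bool) d := t + (if s then - d else d).
pose Good x y := exists2 u : R -> bool -> H,
  forall t s, in_seg x y t s -> exists2 eps, 0 < eps &
    forall d (e : bool), 0 <= d -> (e -> 0 < d) -> d < eps ->
      in_seg x y (sh t s d) (s (+) e) -> u (sh t s d) (s (+) e) = u t s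
  & forall b, x < b < y -> jump u b.
have [] : Good l r.
  apply: cousin => //.
  - move=> x y z lx xy yz zr [u1 L1 J1] [u2 L2 J2].
    (* The value to the right of [y]: if the futures agree it continues [u1], otherwise it continues
       the value of the past. If both agree, [k] does not jump and the two choices coincide. *)
    pose v := (if pselect (f (y, false, true) = f (y, false, false)) then u1 y true
              else u1 y true / k y true * k y false)%g.
    (* Left multiplication by a constant respects local constancy and both clauses of [jump]. *)
    pose u t s := if in_seg x y t s then u1 t s else (v / u2 y false * u2 t s)%g.
    have uy1 : u y true = u1 y true by rewrite /u /in_seg xy lexx.
    have uy2 : u y false = v by rewrite /u /in_seg ltxx andbF mulgVK.
    exists u => [t s I|b /andP[xb bz]].
      have [Ixy|Ixy] := boolP (in_seg x y t s).
        have [eps e0 P] := L1 t s Ixy.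
        exists (Num.min eps (if s then 1 else y - t)).
          move: Ixy; rewrite lt_min e0 /in_seg; case: (s) => //= /andP[_ ty]; lra.
        move=> d e d0 ed; rewrite lt_min => /andP[de dy] I'.
        have I2 : in_seg x y (sh t s d) (s (+) e).
          move: I' Ixy dy; rewrite /in_seg /sh.
          by case: s {I P} ; case: e ed => /= [/(_ isT) ?|_] /andP[? ?] /andP[? ?] ?;
            apply/andP; split; lra.
        by rewrite /u I2 Ixy; exact: P.
      have Iyz : in_seg y z t s by have := in_seg_split y I; rewrite (negbTE Ixy).
      have [eps e0 P] := L2 t s Iyz.
      exists (Num.min eps (if s then t - y else 1)).
        move: Iyz; rewrite lt_min e0 /in_seg; case: (s) => //= /andP[ty _]; lra.
      move=> d e d0 ed; rewrite lt_min => /andP[de dy] I'.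
      have [I2 I3] : in_seg y z (sh t s d) (s (+) e) /\
        in_seg x y (sh t s d) (s (+) e) = false.
        move: I' Iyz dy; rewrite /in_seg /sh.
        by case: s {I P Ixy} ;
          case: e ed => /= [/(_ isT) ?|_] /andP[? ?] /andP[? ?] ?; (split;
            [apply/andP; split; lra|apply/negP => /andP[? ?]; lra]).
      by rewrite /u I3 (negbTE Ixy) P.
    case: (ltgtP b y) => [ltby|ltyb|->].
    + have E s : u b s = u1 b s by rewrite /u /in_seg; case: s;
      rewrite ?xb ?(ltW xb) ?ltby ?(ltW ltby).
      by rewrite /jump !E; apply: J1; rewrite xb.
    + have E s : u b s = (v / u2 y false * u2 b s)%g.
        by rewrite /u /in_seg (lt_gtF ltyb) (lt_geF ltyb) !andbF if_same.
      have [Ja Jb] : jump u2 b by apply: J2; rewrite ltyb.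
      by rewrite /jump !E; split=> [/Ja->//|/Jb]; rewrite -!mulgA => ->.
    + rewrite /jump uy1 uy2 /v; case: pselect => E /=.
        by split=> // E2; rewrite /k E E2.
      by split=> // _; rewrite mulgK.
  - move=> t s I; have [eps1 e1 P1] := fl (t, true, s) I; have [eps2 e2 P2] :=
    fl (t, false, s) I.
    exists (Num.min eps1 eps2) => [|x y lx xy yr xye tE]; first by rewrite lt_min e1.
    (* On a short segment [f] is constant on each level, hence so is [k]. *)
    exists (fun _ _ => 1%g) => [? ? _|b /andP[xb by_]]; first by exists 1.
    have K e : f (b, true, e) = f (t, true, s) /\ f (b, false, e) = f (t, false, s).
      have Ib : in_seg x y b e by rewrite /in_seg; case: e;
        rewrite ?xb ?(ltW xb) ?by_ ?(ltW by_).
      have Ib' : in_seg l r b e by rewrite /in_seg; case: e {Ib}; apply/andP; split;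
        lra.
      have [u [u0 eu uxy] E1] := seg_shift s true Ib; have [u' [u0' eu' uxy'] E2] :=
        seg_shift s false Ib.
      have := le_lt_trans uxy xye; rewrite lt_min => /andP[u1 _].
      have := le_lt_trans uxy' xye; rewrite lt_min => /andP[_ u2].
      rewrite -tE in E1 E2; rewrite E1 E2 P1 ?P2 // -?E1 -?E2 //.
    by have [T1 T2] := K true; have [T3 T4] := K false; split=> // _;
      rewrite /k T1 T2 T3 T4.
move=> u0 L J.
pose u g : H := (if g.1.2 then u0 g.1.1 g.2 / k g.1.1 g.2 else u0 g.1.1 g.2)%g.
exists u; split.
- case=> [[t [|]] s] /=; rewrite /u /germ_rev /=.
    by rewrite /k -etaV invgM invgK.
  by rewrite -/(k t s) mulgVK.
- case=> [[t a] s] /= I; have [eps e0 P] := L t s I.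
  have [eps1 e1 P1] := fl (t, true, s) I; have [eps2 e2 P2] := fl (t, false, s) I.
  exists (Num.min eps (Num.min eps1 eps2)) => [|d e d0 ed];
    first by rewrite !lt_min e0 e1.
  rewrite !lt_min => /and3P[de de1 de2] I'.
  have E0 := P d e d0 ed de I'.
  have E1 := P1 d e d0 ed de1 I'; have E2 := P2 d e d0 ed de2 I'.
  by rewrite /u /=; move: E0 E1 E2; rewrite /sh /germ_shift /k /= => -> -> ->.
- case=> [[t a] s] /= tI; have [Ja Jb] := J t tI; rewrite /u /germ_opp /=.
  by case: a; case: s => /= E;
    [exact/esym/Jb/esym|exact: Jb|exact/esym/Ja/esym|exact: Ja].
Qed.

End Transport.

(** * The canonical morphism of a free group *)

Section Lift.
Context {F : groupType} {U : choiceType} (f : U -> F).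
Implicit Types (a : letter U) (w : freegroup U).

Definition lift_letter a : F := if a.2 then (f a.1)^-1%g else f a.1.

Lemma freegroup_lift_cons a w :
  freegroup_lift f (fg_letter a * w)%g = (lift_letter a * freegroup_lift f w)%g.
Proof.
case: w => [[|b w] rw]; rewrite /freegroup_lift /= ?big_cons //.
case: eqP => [->|_]; rewrite ?big_cons // /lift_letter.
by case: a {rw} => u [] /=; rewrite ?mulKg ?mulVKg.
Qed.

Lemma freegroup_lift1 : freegroup_lift f 1%g = 1%g.
Proof. exact: big_nil. Qed.

Lemma freegroup_liftM x y :
  freegroup_lift f (x * y)%g = (freegroup_lift f x * freegroup_lift f y)%g.
Proof.
move: x; apply: fg_ind => [|a x IH]; first by rewrite mul1g freegroup_lift1 mul1g.
by rewrite -mulgA !freegroup_lift_cons IH mulgA.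
Qed.

Lemma freegroup_liftV x :
  freegroup_lift f (x^-1)%g = (freegroup_lift f x)^-1%g.
Proof.
by apply/esym/mulg1_eq; rewrite -freegroup_liftM mulgV freegroup_lift1.
Qed.

Lemma freegroup_lift_range_subgroup : is_subgroup (range (freegroup_lift f)).
Proof.
split; first by apply/mem_set; exists 1%g; rewrite ?freegroup_lift1.
move=> _ _ /set_mem[x _ <-] /set_mem[y _ <-]; apply/mem_set.
by exists (x / y)%g; rewrite // freegroup_liftM freegroup_liftV.
Qed.

End Lift.

(** * The holonomy cocycle *)

Section Cocycle.
Context {R : realType} {A : finType} (T : linear_involution R A) (a0 : letter A).
Context (G : set (freegroup A)) (Gs : is_subgroup G) (Gf : finite_index G).
Context (nc : without_connection T).
Context {H : groupType} (eta : freegroup A -> H).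
Context (etaV : forall x, eta (x^-1)%g = (eta x)^-1%g).
Implicit Types (a b : letter A) (g : germ R) (d t : R) (h x : freegroup A).

Local Notation germ_letter := (germ_letter T a0).
Local Notation germ_map := (germ_map T a0).
Local Notation germ_iter := (germ_iter T a0).
Local Notation germ_valid := (germ_valid T).
Local Notation germ_word := (germ_word T a0).
Local Notation first_return := (first_return T a0 G).
Local Notation l := (li_left T).
Local Notation r := (li_right T).

Lemma first_return_all h g : germ_valid g -> exists n, first_return h g n.
Proof.
move=> gv; apply: first_return_ex => //; have [Gh|nGh] := pselect (G h).
  have [n n0 Gn] := germ_return a0 Gs Gf gv; exists n => //; exact: subgroupM.
(* Off G, existence is the generation argument with G itself as H: all germs of all strips reach
   G. *)
have XG : prime_words (natural_coding_fg T) G `<=` G by move=> x [[]].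
have [n hn _] := @hits_all _ _ T a0 G Gs Gf nc G Gs XG h g gv.
by exists n; [exact: first_hit_gt0 hn|exact: hn.1].
Qed.

Definition return_word h g : freegroup A :=
  germ_word (xget 0%N [set n | first_return h g n]) g.

Definition hit_word h g : freegroup A :=
  if `[< G h >] then 1%g else return_word h g.

Lemma return_wordE h g n : first_return h g n -> return_word h g = germ_word n g.
Proof.
move=> hn; rewrite /return_word; case: xgetP => [m _ hm|/(_ n)//].
by rewrite (first_return_unique hm hn).
Qed.

Lemma hit_word_in h g : G h -> hit_word h g = 1%g.
Proof. by move=> Gh; rewrite /hit_word asboolT. Qed.

Lemma hit_word_out h g : ~ G h -> hit_word h g = return_word h g.
Proof. by move=> Gh; rewrite /hit_word asboolF. Qed.

Lemma return_word_step h g : germ_valid g -> return_word h g =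
  (fg_letter (germ_letter g) * hit_word (h * fg_letter (germ_letter g)) (germ_map g))%g.
Proof.
move=> gv; have [[[]//|n] hn] := first_return_all h gv; rewrite (return_wordE hn) /=.
congr (_ * _)%g; case: hn => _ /= + nG; rewrite mulgA => Gn.
case: n nG Gn => [|n] nG Gn; first by rewrite /= mulg1 in Gn; rewrite hit_word_in.
have nGa : ~ G (h * fg_letter (germ_letter g))%g.
  by have := nG 1%N isT; rewrite /= mulg1.
rewrite hit_word_out // (@return_wordE _ _ n.+1) //; split=> // i /andP[i0 lti].
by rewrite -mulgA; exact: (nG i.+1).
Qed.

Lemma return_word_step_rev h g : germ_valid g ->
  return_word (h * fg_letter (germ_letter g))%g (germ_rev (germ_map g)) =
  ((fg_letter (germ_letter g))^-1 * hit_word h (germ_rev g))%g.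
Proof.
move=> gv; rewrite return_word_step; last exact: germ_map_valid.
by rewrite germ_letter_rev // fg_letter_inv mulgK germ_map_rev.
Qed.

Lemma first_return_ext h g g' n : first_return h g n ->
  (forall i, (i <= n)%N -> germ_word i g' = germ_word i g) -> first_return h g' n.
Proof.
move=> [n0 Gn nG] E; split; rewrite ?E // => i /andP[i0 lti].
by rewrite E ?(ltnW lti) //; apply: nG; rewrite i0.
Qed.

Lemma return_word_ext h g g' n : first_return h g n ->
  (forall i, (i <= n)%N -> germ_word i g' = germ_word i g) ->
  return_word h g' = return_word h g.
Proof.
move=> hn E; rewrite (return_wordE hn) (return_wordE (first_return_ext hn E)).
exact: E.
Qed.

Lemma return_word_near h : locally_constant l r (return_word h).
Proof.
move=> g gv; have [n hn] := first_return_all h (gv : germ_valid g).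
have [eps e0 P] := germ_near a0 n (gv : germ_valid g).
exists eps => // d e d0 ed de _; have [_ _ E] := P d e d0 ed de.
exact: return_word_ext hn E.
Qed.

Lemma return_word_cross h g : germ_interior T g ->
  return_word h (germ_opp g) = return_word h g \/
  return_word h (germ_rev (germ_opp g)) = return_word h (germ_rev g).
Proof.
move=> gi; have [n hn] := first_return_all h (germ_interior_valid gi).
have [m hm] := first_return_all h (germ_interior_valid (gi : germ_interior T
  (germ_rev g))).
have [L|L] := germ_cross a0 n m nc gi; [left|right].
  apply: (return_word_ext hn) => i lei; apply: germ_word_ext => j ltj.
  by apply: L; exact: leq_trans lei.
apply: (return_word_ext hm) => i lei; apply: germ_word_ext => j ltj.
by apply: L; exact: leq_trans lei.
Qed.

(** The choice depends on the function [f] alone, so elements of one coset, having the same return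
    words, get the same transport. *)
Definition strip_transport (f : germ R -> freegroup A) : germ R -> H :=
  if pselect (exists u, transport l r eta f u) is left ex then sval (cid ex)
  else fun=> 1%g.

Lemma strip_transportP h :
  transport l r eta (return_word h) (strip_transport (return_word h)).
Proof.
rewrite /strip_transport; case: pselect => [ex|[]]; first exact: (svalP (cid ex)).
exact: (transport_ex (li_left_right T) etaV (@return_word_near h)).
Qed.

(* departure h g is the value of the future of g, and arrival h g the same when a
   path that enters the strip of h along g is stopped as soon as h is in G. *)
Definition departure h g : H :=
  if `[< G h >] then eta (return_word h g) else strip_transport (return_word h) g.
Definition arrival h g : H :=
  if `[< G h >] then 1%g else strip_transport (return_word h) g.

Lemma arrival_in h g : G h -> arrival h g = 1%g.
Proof. by move=> Gh; rewrite /arrival asboolT. Qed.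

Lemma arrival_out h g : ~ G h -> arrival h g = departure h g.
Proof. by move=> Gh; rewrite /arrival /departure asboolF. Qed.

(** For [h] in G the past contributes a trivial word and a trivial value, which gives the first
    clause of [transport] the same form on all strips. *)
Lemma departureE h g :
  departure h g = (arrival h (germ_rev g) *
                   eta ((hit_word h (germ_rev g))^-1 * return_word h g))%g.
Proof.
rewrite /departure /arrival /hit_word; case: asboolP => Gh.
  by rewrite invg1 !mul1g.
by have [-> _ _] := strip_transportP h.
Qed.

Lemma departure_near h : locally_constant l r (departure h).
Proof.
move=> g gv; have [_ N _] := strip_transportP h; have [eps e0 P] := N g gv.
have [eps' e0' P'] := return_word_near h gv.
exists (Num.min eps eps') => [|d e d0 ed]; first by rewrite lt_min e0.
rewrite lt_min => /andP[de de'] I.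
by rewrite /departure P // P'.
Qed.

Lemma arrival_near h : locally_constant l r (arrival h).
Proof.
move=> g gv; have [_ N _] := strip_transportP h; have [eps e0 P] := N g gv.
by exists eps => // d e d0 ed de I; rewrite /arrival P.
Qed.

Lemma departure_opp h g : germ_interior T g ->
  return_word h (germ_opp g) = return_word h g ->
  departure h (germ_opp g) = departure h g.
Proof.
move=> gi E; rewrite /departure E; have [_ _ O] := strip_transportP h.
by rewrite O.
Qed.

Lemma arrival_opp h g : germ_interior T g ->
  hit_word h (germ_opp g) = hit_word h g ->
  arrival h (germ_opp g) = arrival h g.
Proof.
move=> gi; rewrite /arrival /hit_word; case: asboolP => // Gh E.
by have [_ _ O] := strip_transportP h; rewrite O.
Qed.

Definition step_label h g : H :=
  (departure h g / arrival (h * fg_letter (germ_letter g)) (germ_map g))%g.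

(** Once both departures are expanded by [departureE], the values of [eta] that occur are at
    mutually inverse words. *)
Lemma step_label_rev h g : germ_valid g ->
  step_label (h * fg_letter (germ_letter g))%g (germ_rev (germ_map g)) =
  (step_label h g)^-1%g.
Proof.
move=> gv; rewrite /step_label germ_letter_rev // germ_map_rev // fg_letter_inv mulgK.
rewrite [in RHS]departureE departureE germ_revK !invgM invgK -etaV !invgM !invgK.
by rewrite return_word_step_rev // return_word_step // !invgM !mulgA.
Qed.

Lemma step_label_opp h g a : li_interval T a g.1 ->
  step_label h (germ_opp g) = step_label h g.
Proof.
move=> Ia; have gi := li_interval_interior Ia.
have ag e : germ_letter (g.1, e) = a.
  by apply: germ_letterE; exact: li_interval_germ.
have lE : germ_letter g = a by rewrite (surjective_pairing g).
have lO : germ_letter (germ_opp g) = a by rewrite ag.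
have mO : germ_map (germ_opp g) = germ_opp (germ_map g).
  by rewrite /germ_map lE lO germ_step_opp.
have gv := germ_interior_valid gi.
have ov : germ_valid (germ_opp g) by exact: germ_interior_valid.
have mi : germ_interior T (germ_map g) by exact: germ_map_interior Ia.
have [E|E] : return_word h (germ_opp g) = return_word h g \/
    hit_word h (germ_rev (germ_opp g)) = hit_word h (germ_rev g).
- have [Gh|nGh] := pselect (G h); first by right; rewrite !hit_word_in.
  by rewrite !hit_word_out //; exact: return_word_cross.
- rewrite /step_label departure_opp // mO lE lO arrival_opp //.
  by move: E; rewrite !return_word_step // lE lO mO => /mulgI.
(* When the pasts are shared, time reversal makes them futures. *)
apply: invg_inj; rewrite -!step_label_rev // mO lE lO /step_label.
rewrite [germ_rev (germ_opp _)]germ_rev_opp departure_opp //; last first.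
  rewrite -germ_rev_opp -mO -{1}lO -lE !return_word_step_rev // lE lO.
  by rewrite E.
rewrite -germ_rev_opp -mO !germ_letter_rev // lE lO !germ_map_rev //.
congr (_ / _)%g; rewrite germ_rev_opp; apply: arrival_opp => //.
by rewrite fg_letter_inv mulgK.
Qed.

(** Departures and arrivals are locally constant, and [step_label_opp] crosses the interior points
    of the interval. *)
Lemma step_label_const h g g' : germ_valid g -> germ_valid g' ->
  germ_letter g = germ_letter g' -> step_label h g = step_label h g'.
Proof.
move=> gv gv' E.
pose a := germ_letter g; pose x0 := li_start T a; pose x1 := x0 + li_len T a.
pose Good (x y : R) := forall (t : R) (s : bool) (t' : R) (s' : bool), in_seg x y t s
  -> in_seg x y t' s' ->
  step_label h (t, li_level T a, s) = step_label h (t', li_level T a, s').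
have x01 : x0 < x1 by rewrite ltrDl li_len_gt0.
have : Good x0 x1.
  apply: cousin => //.
  - move=> x y z lx xy yz zr Gxy Gyz t s t' s'.
    have Ixy : in_seg x y y true by rewrite /in_seg xy lexx.
    have Iyz : in_seg y z y false by rewrite /in_seg yz lexx.
    have Y : step_label h (y, li_level T a, true) =
      step_label h (y, li_level T a, false).
      apply: (@step_label_opp h (y, li_level T a, false) a).
      by rewrite /li_interval /= eqxx (le_lt_trans lx xy) (lt_le_trans yz zr).
    move=> /(in_seg_split y)/orP[I|I] /(in_seg_split y)/orP[I'|I'].
    + exact: Gxy.
    + by rewrite (Gxy _ _ _ _ I Ixy) Y; exact: Gyz.
    + by rewrite (Gyz _ _ _ _ I Iyz) -Y; exact: Gxy.
    + exact: Gyz.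
  - move=> t s I; pose k : germ R := (t, li_level T a, s).
    have ik : germ_in T a k by rewrite /germ_in /= eqxx.
    have kv := germ_in_valid ik; have kl := germ_letterE a0 ik.
    have mv := germ_map_valid a0 kv.
    have [eps1 e1 P1] := germ_near a0 0 kv.
    have [eps2 e2 P2] := departure_near h (kv : in_seg l r k.1.1 k.2).
    have [eps3 e3 P3] := arrival_near (h * fg_letter a)%g (mv : in_seg l r (germ_map
      k).1.1 (germ_map k).2).
    exists (Num.min eps1 (Num.min eps2 eps3)) => [|x y lx xy yr xye tE];
      first by rewrite !lt_min e1 e2.
    suff K (t1 : R) (s1 : bool) : in_seg x y t1 s1 ->
      step_label h (t1, li_level T a, s1) = step_label h k.
      by move=> t1 s1 t2 s2 /K -> /K ->.
    move=> I1; have [u [u0 eu uxy] E1] := seg_shift s (li_level T a) I1.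
    rewrite -tE in E1.
    have := le_lt_trans uxy xye; rewrite !lt_min => /and3P[u1 u2 u3].
    have [L M _] := P1 u _ u0 eu u1.
    have i1 : germ_in T a (t1, li_level T a, s1).
      move: I1; rewrite /germ_in /in_seg /= eqxx /=.
      by rewrite /x1 /x0 in lx yr *; case: ifP => _ /andP[? ?]; apply/andP; split; lra.
    have v1 := germ_in_valid i1; have mv1 := germ_map_valid a0 v1.
    rewrite E1 in v1 mv1 *; rewrite /step_label L M kl P2 // P3 //.
    by move: mv1; rewrite M.
move=> good; have := germ_letterP a0 gv; have := germ_letterP a0 gv';
  rewrite -E -/a => i' i.
have K k : germ_in T a k -> k = (k.1.1, li_level T a, k.2) /\ in_seg x0 x1 k.1.1 k.2.
  by case: k => [[t s] e] /andP[/eqP/= -> ?].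
have [Eg I] := K g i; have [Eg' I'] := K g' i'.
by rewrite Eg Eg'; exact: good.
Qed.

Definition letter_label h a : H := step_label h (li_start T a, li_level T a, false).

Lemma letter_labelE h g a : germ_in T a g -> letter_label h a = step_label h g.
Proof.
move=> ia; have ia' : germ_in T a (li_start T a, li_level T a, false).
  by rewrite /germ_in /= eqxx lexx ltrDl li_len_gt0.
apply: step_label_const; first exact: germ_in_valid ia'.
  exact: germ_in_valid ia.
by rewrite (germ_letterE a0 ia) (germ_letterE a0 ia').
Qed.

Lemma letter_label_inv h a :
  letter_label (h * fg_letter a)%g (letter_inv a) = (letter_label h a)^-1%g.
Proof.
have ia : germ_in T a (li_start T a, li_level T a, false).
  by rewrite /germ_in /= eqxx lexx ltrDl li_len_gt0.
have gv := germ_in_valid ia; have la := germ_letterE a0 ia.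
rewrite [in RHS](letter_labelE h ia) -step_label_rev // la.
by apply: letter_labelE; rewrite /germ_map la; exact: germ_step_in.
Qed.

Fixpoint word_label h (w : seq (letter A)) : H :=
  if w is a :: w' then (letter_label h a * word_label (h * fg_letter a) w')%g
  else 1%g.

Definition holonomy h x : H := word_label h (fg_word x).

Lemma holonomy1 h : holonomy h 1%g = 1%g. Proof. by []. Qed.

(** If the letter cancels, its label cancels too, by [letter_label_inv]. *)
Lemma holonomy_letter h a x :
  holonomy h (fg_letter a * x)%g = (letter_label h a * holonomy (h * fg_letter a) x)%g.
Proof.
rewrite /holonomy /=; case: (fg_word x) => [//|b w] /=; case: eqP => [->|//].
by rewrite letter_label_inv mulVKg fg_letter_inv mulgK.
Qed.

Lemma holonomyM h x y :
  holonomy h (x * y)%g = (holonomy h x * holonomy (h * x) y)%g.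
Proof.
move: x h; apply: fg_ind => [h|a x IH h]; first by rewrite mul1g mulg1 holonomy1 mul1g.
by rewrite -mulgA !holonomy_letter IH !mulgA.
Qed.

Lemma first_return_coset k h g n : G k ->
  first_return (k * h)%g g n <-> first_return h g n.
Proof.
move=> Gk; have E x : G (k * h * x)%g <-> G (h * x)%g.
  by rewrite -mulgA; exact: subgroupMl.
split=> -[n0 /E Gn nG]; split=> // i lti Gi; apply: (nG i lti); exact/E.
Qed.

Lemma step_label_coset k h g : G k -> step_label (k * h)%g g = step_label h g.
Proof.
move=> Gk; have GE x : `[< G (k * x)%g >] = `[< G x >].
  by apply: asbool_equiv_eq; exact: subgroupMl.
have rE x : return_word (k * x)%g = return_word x.
  apply/funext => g'; rewrite /return_word; congr (germ_word (xget _ _) _).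
  by apply/seteqP; split=> n; apply first_return_coset.
by rewrite /step_label /departure /arrival -mulgA !GE !rE.
Qed.

Lemma holonomy_coset k h x : G k -> holonomy (k * h)%g x = holonomy h x.
Proof.
move=> Gk; move: x h; apply: fg_ind => [//|a x IH h].
by rewrite !holonomy_letter -(mulgA k h) IH /letter_label step_label_coset.
Qed.

(** The labels telescope: at intermediate times the path is outside G, where arrival and departure
    agree. *)
Lemma holonomy_germ_word h g n : germ_valid g -> (0 < n)%N ->
  (forall i, (0 < i < n)%N -> ~ G (h * germ_word i g)%g) ->
  holonomy h (germ_word n g) =
  (departure h g / arrival (h * germ_word n g) (germ_iter n g))%g.
Proof.
elim: n h g => [//|n IH] h g gv _ nG.
rewrite [germ_word n.+1 g]/= holonomy_letter (letter_labelE h (germ_letterP a0 gv)).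
case: n IH nG => [|n] IH nG; first by rewrite holonomy1 !mulg1.
have mv := germ_map_valid a0 gv.
have nG' i : (0 < i < n.+1)%N ->
  ~ G (h * fg_letter (germ_letter g) * germ_word i (germ_map g))%g.
  by move=> /andP[i0 lti]; rewrite -mulgA; exact: (nG i.+1).
have nGa : ~ G (h * fg_letter (germ_letter g))%g by have := nG 1%N isT;
  rewrite /= mulg1.
rewrite (IH _ _ mv isT nG') -(arrival_out (germ_map g) nGa) [germ_iter n.+2
  g]germ_iterSr.
by rewrite /step_label !mulgA mulgVK.
Qed.

Lemma holonomy_prime x :
  prime_words (natural_coding_fg T) G x -> holonomy 1%g x = eta x.
Proof.
move=> /(first_return_prime a0)[g [n [gv hn ->]]]; have [n0 Gn nG] := hn.
rewrite holonomy_germ_word // arrival_in // invg1 mulg1.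
by rewrite /departure asboolT ?(return_wordE hn) //; exact: subgroup1.
Qed.

End Cocycle.

(** * Symmetric bases *)

Section SymmetricHalf.
Context {A : choiceType} (X : set (freegroup A)).
Context (XV : forall x, X x -> X (x^-1)%g) (X1 : ~ X 1%g).

(** [choose] depends only on the pair formed by [x] and its inverse, so it selects one of the two
    consistently. *)
Definition inverse_half : set (freegroup A) :=
  [set x | X x /\ choose (pred2 x (x^-1)%g) x = x].

Lemma choose_inverse (x : freegroup A) :
  choose (pred2 (x^-1)%g ((x^-1)^-1)%g) (x^-1)%g = choose (pred2 x (x^-1)%g) x.
Proof.
rewrite invgK (@eq_choose _ _ (pred2 x (x^-1)%g)).
  by apply: choose_id; rewrite /= eqxx ?orbT.
by move=> y /=; rewrite orbC.
Qed.

Lemma inverse_halfU : X = inverse_half `|` [set (y^-1)%g | y in inverse_half].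
Proof.
apply/seteqP; split=> [x Xx|x [[]//|[y [Xy _] <-]]]; last exact: XV.
have : pred2 x (x^-1)%g (choose (pred2 x (x^-1)%g) x).
  by apply: chooseP; rewrite /= eqxx.
move=> /orP[/eqP xE|/eqP xE]; first by left.
right; exists (x^-1)%g; rewrite ?invgK //; split; first exact: XV.
by rewrite choose_inverse.
Qed.

Lemma inverse_half_disjoint x : inverse_half x -> ~ inverse_half (x^-1)%g.
Proof.
move=> [Xx xE] [_]; rewrite choose_inverse xE; apply: fg_neqV => x1.
by apply: X1; rewrite -x1.
Qed.

(** The value 1 off the half and its inverses makes the map compatible with inversion on the whole
    group, as [etaV] requires. *)
Definition half_generator (x : freegroup A) : freegroup inverse_half :=
  match pselect (inverse_half x), pselect (inverse_half (x^-1)%g) with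
  | left p, _ => fg_letter (exist _ x (mem_set p) : inverse_half, false)
  | _, left p => fg_letter (exist _ (x^-1)%g (mem_set p) : inverse_half, true)
  | _, _ => 1%g
  end.

Lemma half_generatorE (y : inverse_half) :
  half_generator (val y) = fg_letter (y, false).
Proof.
rewrite /half_generator; case: pselect => [p|[]]; last exact: set_mem (valP y).
by congr (fg_letter (_, _)); apply: val_inj.
Qed.

Lemma half_generatorV x : half_generator (x^-1)%g = ((half_generator x)^-1)%g.
Proof.
have VE (y : inverse_half) : half_generator ((val y)^-1)%g = fg_letter (y, true).
  rewrite /half_generator; case: pselect => [p|_].
    by case: (inverse_half_disjoint (set_mem (valP y)) p).
  case: pselect => [p|[]]; last by rewrite invgK; exact: set_mem (valP y).
  by congr (fg_letter (_, _)); apply: val_inj; rewrite /= invgK.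
have [p|np] := pselect (inverse_half x).
  pose y : inverse_half := exist _ x (mem_set p).
  by rewrite (VE y) (half_generatorE y) -fg_letter_inv.
have [p|np'] := pselect (inverse_half (x^-1)%g).
  pose y : inverse_half := exist _ (x^-1)%g (mem_set p).
  rewrite (half_generatorE y); have := VE y; rewrite /= invgK => ->.
  by rewrite -fg_letter_inv.
rewrite /half_generator invgK; case: pselect => // _; case: pselect => // _.
by rewrite invg1.
Qed.

Lemma half_generator_letter (a : letter inverse_half) :
  half_generator (lift_letter (fun y : inverse_half => val y) a) = fg_letter a.
Proof.
case: a => y []; rewrite /lift_letter /= ?half_generatorE //.
by rewrite half_generatorV half_generatorE -fg_letter_inv.
Qed.

End SymmetricHalf.

(** The reversed orbit reads the inverse word, and an early return of it would give one of the orbit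
    itself. *)
Lemma prime_wordsV (R : realType) (A : finType) (T : linear_involution R A)
    (a0 : letter A) (G : set (freegroup A)) (x : freegroup A) : is_subgroup G ->
  prime_words (natural_coding_fg T) G x -> prime_words (natural_coding_fg T) G (x^-1)%g.
Proof.
move=> Gs /(first_return_prime a0)[g [n [gv [n0 Gn nG] ->]]].
rewrite mul1g in Gn; rewrite -(germ_word_rev a0) //.
apply: (@prime_first_return _ _ _ a0 G Gs 1%g) => //.
- exact: germ_iter_valid.
- exact: subgroup1.
split; rewrite // ?mul1g; first by rewrite germ_word_rev //; exact: subgroupV.
move=> i /andP[i0 lti]; rewrite mul1g => Gi.
have := @retrace_word_le _ _ T a0 (germ_rev g) n i gv (ltnW lti);
  rewrite germ_revK => E.
apply: (nG (n - i)%N); first by rewrite subn_gt0 lti ltn_subrL i0.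
by rewrite mul1g -E; exact: subgroupM.
Qed.

Theorem theorem6p9 (R : realType) (A : finType) (T : linear_involution R A)
  (G : set (freegroup A)) :
  without_connection T -> is_subgroup G -> finite_index G ->
  symmetric_basis G (prime_words (natural_coding_fg T) G).
Proof.
move=> nc Gs Gf.
pose g0 : germ R := (li_left T, false, false).
have gv : germ_valid T g0 by rewrite /germ_valid /= lexx li_left_right.
have [a0 _] := germ_in_ex gv.
set X := prime_words _ _.
have XG : X `<=` G by move=> x [[]].
have XV x : X x -> X (x^-1)%g by exact: prime_wordsV.
have X1 : ~ X 1%g by move=> [_ /(_ erefl)].
pose Y := inverse_half X; pose f := freegroup_lift (fun y : Y => val y).
have fX (a : letter Y) : X (lift_letter (fun y : Y => val y) a).
  have Xy (y : Y) : X (val y) by have [] := set_mem (valP y).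
  by case: a => y []; rewrite /lift_letter /=; [exact/XV/Xy|exact: Xy].
exists Y; last exact: inverse_halfU.
split.
- move=> w _ /=; move: w; apply: fg_ind => [|a w IH].
    by rewrite freegroup_lift1; exact: subgroup1.
  by rewrite freegroup_lift_cons; apply: subgroupM => //; exact/XG.
(* Freeness: the holonomy from 1 is a left inverse of [f]. It inverts each generator by
   [holonomy_prime], and it is multiplicative there because [f] stays in G. *)
- apply: (can_in_inj (g := holonomy T a0 G (@half_generator A X) 1%g)) => w _.
  move: w; apply: fg_ind => [|a w IH]; first by rewrite freegroup_lift1.
  have eV := half_generatorV X1.
  have Ga := XG _ (fX a).
  rewrite freegroup_lift_cons (holonomyM a0 Gs Gf nc eV) (holonomy_prime a0 Gs Gf nc
    eV (fX a)).
  rewrite (half_generator_letter X1).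
  congr (_ * _)%g; rewrite mul1g -[X in holonomy _ _ _ _ X]mulg1.
  by rewrite (holonomy_coset a0 Gs Gf nc).
(* Generation, with the range of [f] as H: for [x] in G the first hit is at time 0, so a hit inside
   H means that [x] is in the range. *)
- move=> x Gx.
  have Hs := freegroup_lift_range_subgroup (fun y : Y => val y).
  have XH : X `<=` range f.
    move=> x' Xx'; have : (Y `|` [set (y^-1)%g | y in Y]) x' by rewrite -inverse_halfU.
    case=> [Yx|[y Yy <-]].
      by exists (fg_letter (exist _ x' (mem_set Yx) : Y, false));
        rewrite // /f /freegroup_lift /= big_seq1.
    by exists (fg_letter (exist _ y (mem_set Yy) : Y, true));
      rewrite // /f /freegroup_lift /= big_seq1.
  by apply/(hits0 T a0 (range f) g0 Gx); exact: hits_all.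
Qed.
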